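(* For each $\hbar>0$ let $F=F_\hbar=S(L+X^{-1}R)(E_p+Y^{-1/2}O_p)$ be the operator on $L^2(\mathbb{R})$ described in the context. Then $F$ has a weak classical limit: for every function $A(x,p)=\sum_{a,b\in\mathbb{Z}}A_{ab}e^{2\pi i(ax+bp)}$ on the torus $\mathbb{T}^2$ and for almost every $(x_0,p_0)\in\mathbb{R}^2$, $$\lim_{\hbar\to0}\Big(\langle \phi_\hbar;x_0,p_0|\,F^\dagger Q_\hbar(A)F\,|\phi_\hbar;x_0,p_0\rangle-\langle \phi_\hbar;\beta(x_0,p_0)|\,Q_\hbar(A)\,|\phi_\hbar;\beta(x_0,p_0)\rangle\Big)=0 .$$
   Context: $\widehat x$ is multiplication by $x$ and $\widehat p=(\hbar/i)d/dx$ on $L^2(\mathbb{R})$; $U=e^{2\pi i\widehat x}$, $V=e^{2\pi i\widehat p}$; $Q_\hbar(A)=\sum_{a,b}A_{ab}U^aV^b$. For real $s$, $X^{s}=e^{is\widehat{x}/\hbar}$, $Y^{s}=e^{is\widehat{p}/\hbar}$. $S=\exp\!\big(-\tfrac{i\log 2}{2\hbar}(\widehat{x}\widehat{p}+\widehat{p}\widehat{x})\big)$. $L$, $R$ are multiplication by the indicators of $[0,1/2)+\mathbb{Z}$ and $[1/2,1)+\mathbb{Z}$; $E_p$, $O_p$ are the spectral projections of $\widehat p$ onto $[0,1)+2\mathbb{Z}$ and $[1,2)+2\mathbb{Z}$. The coherent state $|\phi_\hbar;x_0,p_0\rangle$ has wave function $\phi(x)=(\pi\hbar)^{-1/4}e^{-(x-x_0)^2/2\hbar}e^{ip_0x/\hbar-ip_0x_0/2\hbar}$.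 The classical map $\beta:\mathbb{R}^2\to\mathbb{R}^2$ (baker covering map) is: $\beta(x,p)=(2x,p/2)$ if $x\in[0,1/2)+\mathbb{Z}$, $p\in[0,1)+2\mathbb{Z}$; $(2x-1,p/2+1/2)$ if $x\in[1/2,1)+\mathbb{Z}$, $p\in[0,1)+2\mathbb{Z}$; $(2x+1,p/2+1/2)$ if $x\in[0,1/2)+\mathbb{Z}$, $p\in[1,2)+2\mathbb{Z}$; $(2x,p/2)$ if $x\in[1/2,1)+\mathbb{Z}$, $p\in[1,2)+2\mathbb{Z}$. *)

(* Defs.v *)
From mathcomp Require Import all_boot all_order all_algebra.
From mathcomp Require Import all_classical all_reals all_analysis.
From mathcomp Require Export complex.
Import Order.TTheory GRing.Theory Num.Theory.
Import numFieldNormedType.Exports.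
Local Open Scope ring_scope.
Local Open Scope classical_set_scope.
Local Open Scope complex_scope.

Set Implicit Arguments.
Unset Strict Implicit.
Unset Printing Implicit Defensive.

Section Baker.
Variable R : realType.
Local Notation C := R[i].

Definition cabs (z : C) : R := Num.sqrt (complex.Re z ^+ 2 + complex.Im z ^+ 2).

Definition expi (t : R) : C := cos t +i* sin t.

Definition cint (f : R -> C) : C :=
  (Rintegral (@lebesgue_measure R) setT (fun x => complex.Re (f x))) +i*
  (Rintegral (@lebesgue_measure R) setT (fun x => complex.Im (f x))).

Definition climn (u : nat -> C) : C :=
  (limn (fun n => complex.Re (u n))) +i* (limn (fun n => complex.Im (u n))).

Definition ind (b : bool) : C := if b then 1 else 0.

Definition inLeft (x : R) : bool := x - (Num.floor x)%:~R < 2^-1.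
Definition inEven (p : R) : bool := p / 2 - (Num.floor (p / 2))%:~R < 2^-1.

Definition fourier (h : R) (f : R -> C) (p : R) : C :=
  cint (fun y => f y * expi (- (p * y) / h)).

(* spectral projections of p^ = (hbar/i) d/dx onto [0,1)+2Z and [1,2)+2Z,
   written through Fourier inversion  f(x) = (2 pi hbar)^{-1} int f^(p) e^{ipx/hbar} dp *)
Definition Ep (h : R) (f : R -> C) (x : R) : C :=
  ((2 * pi * h)^-1)%:C *
  cint (fun p => ind (inEven p) * fourier h f p * expi (p * x / h)).
Definition Op (h : R) (f : R -> C) (x : R) : C :=
  ((2 * pi * h)^-1)%:C *
  cint (fun p => ind (~~ inEven p) * fourier h f p * expi (p * x / h)).

Definition Xop (h s : R) (f : R -> C) (x : R) : C := expi (s * x / h) * f x.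
(* Y^s = e^{i s p^/hbar} = e^{s d/dx} : translation (Y^s f)(x) = f(x + s) *)
Definition Yop (s : R) (f : R -> C) (x : R) : C := f (x + s).
(* S = exp(-(i log 2/(2 hbar))(x^p^+p^x^)) : (S f)(x) = 2^{-1/2} f(x/2) *)
Definition Sop (f : R -> C) (x : R) : C := ((Num.sqrt 2)^-1)%:C * f (x / 2).
Definition Lop (f : R -> C) (x : R) : C := ind (inLeft x) * f x.
Definition Rop (f : R -> C) (x : R) : C := ind (~~ inLeft x) * f x.

Definition Fop (h : R) (f : R -> C) : R -> C :=
  let g := fun x => Ep h f x + Yop (- 2^-1) (Op h f) x in
  Sop (fun x => Lop g x + Xop h (-1) (Rop g) x).

Definition coh (h x0 p0 : R) (x : R) : C :=
  (powR (pi * h) (- 4^-1))%:C * (expR (- (x - x0) ^+ 2 / (2 * h)))%:C *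
  expi (p0 * x / h - p0 * x0 / (2 * h)).

(* (U^a V^b f)(x) = e^{2 pi i a x} f(x + 2 pi hbar b), with U = e^{2 pi i x^},
   V = e^{2 pi i p^} *)
Definition UV (h : R) (a b : int) (f : R -> C) (x : R) : C :=
  expi (2 * pi * a%:~R * x) * f (x + 2 * pi * h * b%:~R).

Definition braket (f g : R -> C) : C := cint (fun x => (f x)^* * g x).

Definition zidx (N : nat) (i : 'I_(N.*2).+1) : int := (i : nat)%:Z - N%:Z.

(* square partial sums of <psi| Q_hbar(A) |psi> = sum_{a,b} A_ab <psi|U^a V^b|psi> *)
Definition Qpart (h : R) (A : int -> int -> C) (psi : R -> C) (N : nat) : C :=
  \sum_(i < (N.*2).+1) \sum_(j < (N.*2).+1)
     A (zidx i) (zidx j) * braket psi (UV h (zidx i) (zidx j) psi).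

Definition Qexp (h : R) (A : int -> int -> C) (psi : R -> C) : C :=
  climn (Qpart h A psi).

Definition abs_summable (A : int -> int -> C) : Prop :=
  exists M : R, forall N : nat,
    \sum_(i < (N.*2).+1) \sum_(j < (N.*2).+1) cabs (A (zidx i) (zidx j)) <= M.

Definition beta (z : R * R) : R * R :=
  let x := z.1 in let p := z.2 in
  if inEven p then
    (if inLeft x then (2 * x, p / 2) else (2 * x - 1, p / 2 + 2^-1))
  else
    (if inLeft x then (2 * x + 1, p / 2 + 2^-1) else (2 * x, p / 2)).

End Baker.

(* Main.v *)
(* A coherent state at (x0, p0) is concentrated, up to an O(hbar) error in squared
   L2 norm, in the half-cell of x0 and in the momentum band of p0 whenever
   2 x0 and p0 are not integers, which excludes only a null set.  Hence
   F |phi> is L2-close to a single squeezed Gaussian packet centred at a point which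
   differs from beta(x0, p0) by an element of Z^2, and U^a V^b does not see such a
   shift.  The matrix elements of U^a V^b in Gaussian packets are explicit and tend
   to exp(2 pi i (a x + b p)); dominated summation over (a, b) concludes.

   The only point where the spectral projections enter is the bound on the wrong
   momentum band e(x) = int g(p) exp(i p x / hbar) dp, with g >= 0 a truncated
   Gaussian.  Instead of Plancherel's theorem, Fubini with the weight
   exp(- (x - x0)^2 / v) gives int |e|^2 w = int int g(p) g(q) w^(p - q), which is at
   most 2 pi hbar (sup g) (int g) uniformly in v, and v tends to infinity. *)
Require Import Defs.
From mathcomp Require Import all_boot all_order all_algebra.
From mathcomp Require Import all_classical all_reals all_analysis.
From mathcomp Require Import measurable_realfun.
From mathcomp Require Import complex.
From mathcomp Require Import zify ring lra.
Import Order.TTheory GRing.Theory Num.Theory.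
Import numFieldNormedType.Exports.
Local Open Scope ring_scope.
Local Open Scope classical_set_scope.
Local Open Scope complex_scope.

Set Implicit Arguments.
Unset Strict Implicit.
Unset Printing Implicit Defensive.

(** * Lebesgue integration on the line *)

Section Integration.
Variable R : realType.
Local Notation mu := (@lebesgue_measure R).
Local Notation Int f := (Rintegral mu setT f).
Local Notation intble f := (mu.-integrable setT (EFin \o f)).

(** Only the wrong momentum band is ever estimated: [Ep] and [Op] add up to the identity on a
    coherent state by explicit Gaussian integrals, so the right band is the state minus the wrong
    one. The amplitude g is real and nonnegative because the phase of the Fourier transform of the
    state merges with the plane wave into [p * (x - X) / h] plus a constant. The dilation in F turns
    the width [h] into [4 * h], so F does not produce a coherent state. The comparison survives
    because the width enters the matrix elements only through a damping factor tending to 1, and the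
    global phase cancels. A squared L2 error [K * h] becomes an error of order [Num.sqrt h] in the
    matrix elements, by a Cauchy-Schwarz bound whose free weight is set to [Num.sqrt h]. The defect
    of the damping factors is of order [h], but its bound grows quadratically in (a, b). Convergence
    is therefore not claimed uniformly in the modes: a finite square of modes uses the rate, and the
    summable tail of the coefficients uses a uniform bound. *)

Lemma dominated_intble (f g : R -> R) :
  measurable_fun setT f -> (forall x, `|f x| <= g x) -> intble g -> intble f.
Proof.
move=> mf fg; apply: le_integrable => //; first exact/measurable_EFinP.
by move=> x _ /=; rewrite lee_fin (le_trans (fg x)) ?ler_norm.
Qed.

Lemma intble_measurable (f : R -> R) : intble f -> measurable_fun setT f.
Proof. by move=> /measurable_int/measurable_EFinP. Qed.

Lemma EFin_Int (f : R -> R) : intble f -> (\int[mu]_x (f x)%:E)%E = (Int f)%:E.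
Proof. by move=> fi; rewrite /Rintegral fineK//; exact: integrable_fin_num. Qed.

Lemma intbleZ (k : R) (f : R -> R) : intble f -> intble (fun x => k * f x).
Proof. by move=> fi; apply: eq_integrable (integrableZl measurableT k fi). Qed.

Lemma intbleD (f g : R -> R) : intble f -> intble g -> intble (fun x => f x + g x).
Proof. by move=> fi gi; apply: eq_integrable (integrableD measurableT fi gi). Qed.

Lemma measurable_affine (a b : R) : measurable_fun setT (fun x : R => a * x + b).
Proof. by apply: measurable_funD => //; apply: measurable_funM. Qed.

(** The pushforward of Lebesgue measure along [a * x + b], multiplied by [a], agrees with Lebesgue
    measure on half-open intervals, hence everywhere by uniqueness. *)
Lemma ge0_integral_affine (a b : R) (f : R -> \bar R) : 0 < a ->
  measurable_fun setT f -> (forall x, (0 <= f x)%E) ->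
  (\int[mu]_x f (a * x + b)%R = (a^-1)%:E * \int[mu]_x f x)%E.
Proof.
move=> a0 mf f0; have an0 : a != 0 by rewrite gt_eqF.
pose phi (x : measurableTypeR R) : measurableTypeR R := a * x + b.
have mphi : measurable_fun setT phi by exact: measurable_affine.
pose a' : {nonneg R} := NngNum (ltW a0).
pose pf : {measure set (measurableTypeR R) -> \bar R} := pushforward mu phi.
pose nu : {measure set (measurableTypeR R) -> \bar R} := mscale a' (pf mphi).
have -> : (\int[mu]_x f x = \int[nu]_x f x)%E.
  apply: (eq_measure_integral nu) => A mA _; apply: lebesgue_measure_unique => //.
  move=> _ [[u v] _ <-] /=; rewrite /mscale /= /pushforward.
  have -> : phi @^-1` `]u, v] = `](u - b) / a, (v - b) / a]%classic.
    apply/seteqP; split=> x /=; rewrite /phi !in_itv/= => /andP[h1 h2].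
      by rewrite ltr_pdivrMr// ler_pdivlMr// mulrC ltrBlDr h1 lerBrDr h2.
    move: h1 h2; rewrite ltr_pdivrMr// ler_pdivlMr// mulrC ltrBlDr => ->.
    by rewrite lerBrDr => ->.
  rewrite !lebesgue_measure_itv/= !lte_fin ltr_pM2r ?invr_gt0// ltrD2r.
  case: ifPn => _; last by rewrite mule0.
  by rewrite -!EFinD -EFinM; congr EFin; field.
rewrite (ge0_integral_mscale (pf mphi))//= (ge0_integral_pushforward mphi)//=.
by rewrite muleA -EFinM mulVf// mul1e preimage_setT.
Qed.

Lemma intble_affine (a b : R) (f : R -> R) : 0 < a -> intble f ->
  intble (fun x => f (a * x + b)).
Proof.
move=> a0 fi; have mf := intble_measurable fi; apply/integrableP; split.
  by apply/measurable_EFinP; apply: measurableT_comp => //; exact: measurable_affine.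
rewrite (@ge0_integral_affine a b (fun x => `|(f x)%:E|%E))//; last first.
  by apply/measurable_EFinP; exact: measurableT_comp.
move/integrableP : fi => [_]; rewrite /comp => fi.
by rewrite lte_mul_pinfty// lee_fin invr_ge0 ltW.
Qed.

Lemma Int_affine (a b : R) (f : R -> R) : 0 < a -> intble f ->
  Int (fun x => f (a * x + b)) = a^-1 * Int f.
Proof.
move=> a0 fi; have mf := intble_measurable fi.
have /measurable_EFinP emf := mf.
apply: EFin_inj; rewrite -EFin_Int; last exact: intble_affine.
rewrite EFinM -EFin_Int// integralE [in RHS]integralE muleBr//; last first.
  exact: integrable_add_def.
congr (_ - _)%E.
  rewrite -(@ge0_integral_affine a b)//; last exact: measurable_funepos.
  by apply: eq_integral => x _; rewrite !funeposE.
rewrite -(@ge0_integral_affine a b)//; last exact: measurable_funeneg.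
by apply: eq_integral => x _; rewrite !funenegE.
Qed.

Lemma le_eint (f g : R -> R) : measurable_fun setT f -> measurable_fun setT g ->
  (forall x, 0 <= f x) -> (forall x, f x <= g x) ->
  (\int[mu]_x (f x)%:E <= \int[mu]_x (g x)%:E)%E.
Proof.
move=> /measurable_EFinP mf /measurable_EFinP mg f0 fg.
by apply: ge0_le_integral => // x _; rewrite lee_fin.
Qed.

Lemma ge0_Int_bound (f : R -> R) (M : R) : measurable_fun setT f ->
  (forall x, 0 <= f x) -> (\int[mu]_x (f x)%:E <= M%:E)%E ->
  intble f /\ Int f <= M.
Proof.
move=> mf f0 fM; have fi : intble f.
  apply/integrableP; split; first exact/measurable_EFinP.
  under eq_integral do rewrite /= ger0_norm//.
  by rewrite (le_lt_trans fM)// ltry.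
by split=> //; rewrite -lee_fin -EFin_Int.
Qed.

(** * Fubini for integrands with a product majorant *)

Section Fubini.
Variables (f : R -> R -> R) (g1 g2 : R -> R).
Hypothesis mf : measurable_fun setT (fun z : R * R => f z.1 z.2).
Hypotheses (ig1 : intble g1) (ig2 : intble g2).
Hypothesis fg : forall x y, `|f x y| <= g1 x * g2 y.

Let mfx x : measurable_fun setT (f x).
Proof. by have := measurableT_comp mf (@measurable_pair1 _ _ R R x). Qed.

Let mfy y : measurable_fun setT (f ^~ y).
Proof. by have := measurableT_comp mf (@measurable_pair2 _ _ R R y). Qed.

Lemma intble_section1 x : intble (f x).
Proof. exact: (dominated_intble (mfx x) (fg x)) (intbleZ _ ig2). Qed.

Lemma intble_section2 y : intble (f ^~ y).
Proof.
apply: (dominated_intble (mfy y) (g := fun x => g2 y * g1 x)).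
  by move=> x; rewrite mulrC.
exact: intbleZ.
Qed.

(** Tonelli reduces the claim to the iterated integral of [|f|], which is at most the product of the
    L1 norms of [g1] and [g2]. *)
Lemma intble_prod : (mu \x mu)%E.-integrable setT (fun z : R * R => (f z.1 z.2)%:E).
Proof.
have emf : measurable_fun setT (fun z : R * R => (f z.1 z.2)%:E).
  exact/measurable_EFinP.
apply/(integrable12ltyP mu mu emf) => /=.
pose h x := `|g1 x| * Int (fun y => `|g2 y|).
have ih : intble h.
  apply: (@dominated_intble _ (fun x => Int (fun y => `|g2 y|) * `|g1 x|)).
  - apply: measurable_funM => //; apply: measurableT_comp => //.
    exact: intble_measurable.
  - move=> x; rewrite /h mulrC normrM !normr_id ger0_norm//.
    by apply: Rintegral_ge0 => y _.
  - by apply: intbleZ; exact: integrable_norm.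
apply: (@le_lt_trans _ _ (\int[mu]_x (h x)%:E)%E); last first.
  by rewrite EFin_Int// ltry.
apply: ge0_le_integral => //=.
- by move=> x _; apply: integral_ge0.
- have := @measurable_fun_fubini_tonelli_F _ _ _ _ R mu
    (fun z : R * R => `|f z.1 z.2|%:E); apply=> //.
  by apply/measurable_EFinP; exact: measurableT_comp.
- by move/measurable_int : ih.
move=> x _; rewrite /h EFinM -EFin_Int; last exact: integrable_norm.
have mg2 : measurable_fun setT (fun y => `|g2 y|).
  by apply: measurableT_comp => //; exact: intble_measurable.
rewrite -ge0_integralZl//; last exact/measurable_EFinP.
apply: (@le_eint _ (fun y => `|g1 x| * `|g2 y|)) => //.
- exact: measurableT_comp.
- exact: measurable_funM.
by move=> y; rewrite -normrM (le_trans (fg _ _))// ler_norm.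
Qed.

Lemma intble_Int1 : intble (fun x => Int (f x)).
Proof.
apply: eq_integrable (integrable_fubini_F intble_prod) => // x _.
by rewrite /fubini_F /= EFin_Int//; exact: intble_section1.
Qed.

Lemma Int_swap : Int (fun x => Int (f x)) = Int (fun y => Int (f ^~ y)).
Proof.
apply: (congr1 fine).
transitivity (\int[mu]_x \int[mu]_y (f x y)%:E)%E.
  by apply: eq_integral => x _; rewrite -EFin_Int//; exact: intble_section1.
rewrite (Fubini intble_prod) /=.
by apply: eq_integral => y _; rewrite -EFin_Int//; exact: intble_section2.
Qed.

End Fubini.

End Integration.

(** * Fourier transform of Gaussians *)

Section Gaussian.
Variable R : realType.
Local Notation mu := (@lebesgue_measure R).
Local Notation Int f := (Rintegral mu setT f).
Local Notation intble f := (mu.-integrable setT (EFin \o f)).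

(** The integrals over growing symmetric intervals have two limits: the full integral, by dominated
    convergence, and zero, by the fundamental theorem of calculus and the vanishing boundary
    values. *)
Lemma Int_derive_eq0 (F f : R -> R) : (forall x : R, is_derive x (1 : R) F (f x)) ->
  continuous f -> intble f ->
  F n.+1%:R @[n --> \oo] --> 0 -> F (- n.+1%:R) @[n --> \oo] --> 0 -> Int f = 0.
Proof.
move=> dF cf fi Fp Fn; have mf := intble_measurable fi.
(* [n.+1] keeps the interval nondegenerate at [n = 0], as the fundamental theorem of calculus
   requires. *)
pose I n := `[- n.+1%:R, n.+1%:R]%classic : set R.
have cF : continuous F.
  by move=> x; apply/differentiable_continuous/derivable1_diffP; apply: ex_derive.
have cvg1 : (\int[mu]_(x in I n) (f x)%:E)%E @[n --> \oo] --> (\int[mu]_x (f x)%:E)%E.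
  have [||||//|_ _] := @dominated_convergence _ _ R mu setT measurableT
    (fun n => (EFin \o f) \_ (I n)) (EFin \o f) (fun x => `|f x|%:E).
  - move=> n; apply/(measurable_restrictT _ _).1; first exact: measurable_itv.
    by apply/measurable_EFinP; exact: measurable_funTS.
  - exact/measurable_EFinP.
  - apply: aeW => x _; apply: cvg_near_cst.
    exists (Num.bound `|x|) => // n /= xn; rewrite patchE ifT// inE /I /= in_itv/=.
    rewrite -ler_norml ltW// (lt_le_trans (archi_boundP (normr_ge0 x)))//.
    by rewrite ler_nat ltnW.
  - exact: integrable_norm.
  - apply: aeW => x n _; rewrite patchE; case: ifPn => _; first by rewrite /= lexx.
    by rewrite abse0 lee_fin.
  by under eq_fun do rewrite -integral_mkcond.
have cvg2 : (F n.+1%:R - F (- n.+1%:R))%:E @[n --> \oo] --> (0 : \bar R)%E.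
  by apply: cvg_EFin; [exact: nearW|rewrite -[X in _ --> X](subr0 0); exact: cvgB].
apply: EFin_inj; rewrite -EFin_Int//.
apply: (cvg_unique _ cvg1) => //.
rewrite (_ : (fun n => _) = (fun n => (F n.+1%:R - F (- n.+1%:R))%:E))//.
apply/funext => n; rewrite EFinB; apply: continuous_FTC2.
- by rewrite -subr_gt0 opprK addr_gt0 ?ltr0n.
- exact: continuous_subspaceT.
- split; first by move=> x _; exact: ex_derive.
  + by apply: cvg_at_right_filter; exact: cF.
  + by apply: cvg_at_left_filter; exact: cF.
- by move=> x _; rewrite derive1E derive_val.
Qed.

Lemma intble_gauss : intble (@gauss_fun R).
Proof.
apply/integrableP; split; first by apply/measurable_EFinP; exact: measurable_gauss_fun.
under eq_integral do rewrite /= ger0_norm ?gauss_fun_ge0//.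
by rewrite integralT_gauss ltry.
Qed.

Lemma Int_gauss : Int (@gauss_fun R) = Num.sqrt pi.
Proof. by rewrite /Rintegral integralT_gauss. Qed.

Lemma gauss_affineE (m v y : R) : 0 < v ->
  gauss_fun ((Num.sqrt v)^-1 * y + - ((Num.sqrt v)^-1 * m)) = expR (- ((y - m) ^+ 2 / v)).
Proof.
move=> v0; rewrite /gauss_fun -mulrBr exprMn exprVn sqr_sqrtr ?(ltW v0)//.
by rewrite mulrC.
Qed.

Lemma intble_gaussv (m v : R) : 0 < v -> intble (fun y => expR (- ((y - m) ^+ 2 / v))).
Proof.
move=> v0; have s0 : 0 < (Num.sqrt v)^-1 by rewrite invr_gt0 sqrtr_gt0.
apply: eq_integrable (intble_affine (- ((Num.sqrt v)^-1 * m)) s0 intble_gauss) => //.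
by move=> y _ /=; rewrite gauss_affineE.
Qed.

Lemma is_derive_affine (a b x : R) : is_derive x (1 : R) (fun x => a * x + b) a.
Proof.
have := is_deriveD (is_deriveZ a (is_derive_id x (1 : R))) (is_derive_cst b x (1 : R)).
by rewrite addr0 /GRing.scale /= mulr1.
Qed.

Lemma is_derive_gauss (y : R) : is_derive y (1 : R) (@gauss_fun R) (- 2 * y * gauss_fun y).
Proof.
have h : is_derive y (1 : R) (fun y : R => - y ^+ 2) (- 2 * y).
  apply: is_derive_eq (is_deriveN (is_deriveX 2 (is_derive_id y (1 : R)))) _.
  by rewrite /GRing.scale /= expr1 mulr1 mulNr.
apply: is_derive_eq (@is_derive1_comp R expR _ y _ _ (is_derive_expR _) h) _.
by rewrite mulrC.
Qed.

Lemma is_derive_cos_affine (a b x : R) :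
  is_derive x (1 : R) (fun x => cos (a * x + b)) (- a * sin (a * x + b)).
Proof.
have h := @is_derive1_comp R cos (fun x => a * x + b) x _ _
  (is_derive_cos (a * x + b)) (is_derive_affine a b x).
by apply: (is_derive_eq h); ring.
Qed.

Lemma is_derive_sin_affine (a b x : R) :
  is_derive x (1 : R) (fun x => sin (a * x + b)) (a * cos (a * x + b)).
Proof.
have h := @is_derive1_comp R sin (fun x => a * x + b) x _ _
  (is_derive_sin (a * x + b)) (is_derive_affine a b x).
by apply: (is_derive_eq h); rewrite mulrC.
Qed.

(** Half of the Gaussian exponent absorbs the linear factor: [|y| <= 1 + y ^+ 2 / 2 <= expR (y ^+ 2
    / 2)]. The result is the majorant for differentiating under the integral sign. *)
Lemma mul_gauss_le (y : R) : `|y * gauss_fun y| <= expR (- ((y - 0) ^+ 2 / 2)).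
Proof.
rewrite subr0 normrM (ger0_norm (gauss_fun_ge0 _)) /gauss_fun.
rewrite (_ : - y ^+ 2 = - (y ^+ 2 / 2) + - (y ^+ 2 / 2)); last by field.
rewrite expRD mulrA ler_piMl ?expR_ge0// expRN ler_pdivrMr ?expR_gt0// mul1r.
apply: le_trans (expR_ge1Dx _); have := sqr_ge0 (`|y| - 1).
by rewrite sqrrB1 real_normK ?num_real//; lra.
Qed.

(** * Cosine transform of the Gaussian with a free phase *)

Section FourierTransform.
Variable t : R.
(* By differentiation under the integral and integration by parts,
   Phi' = - (k / 2) Phi. *)
Let Phi (k : R) := Int (fun y => gauss_fun y * cos (k * y + t)).

Let mcos (k : R) : measurable_fun setT (fun y : R => cos (k * y + t)).
Proof.
apply: measurableT_comp; last exact: measurable_affine.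
by apply: continuous_measurable_fun; exact: continuous_cos.
Qed.

Let msin (k : R) : measurable_fun setT (fun y : R => sin (k * y + t)).
Proof.
apply: measurableT_comp; last exact: measurable_affine.
by apply: continuous_measurable_fun; exact: continuous_sin.
Qed.

Let intble_cos k : intble (fun y => gauss_fun y * cos (k * y + t)).
Proof.
apply: dominated_intble intble_gauss.
  by apply: measurable_funM => //; exact: measurable_gauss_fun.
by move=> y; rewrite normrM ger0_norm ?gauss_fun_ge0// ler_piMr ?gauss_fun_ge0// cos_max.
Qed.

Let intble_ysin k : intble (fun y => y * gauss_fun y * sin (k * y + t)).
Proof.
apply: dominated_intble (intble_gaussv 0 (ltr0n R 2)).
  apply: measurable_funM => //; apply: measurable_funM => //.
  exact: measurable_gauss_fun.
move=> y; rewrite normrM; apply: le_trans (mul_gauss_le y).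
by rewrite ler_piMr// sin_max.
Qed.

(** The derivative of [gauss_fun y * sin (k * y + t)] in [y] has integral zero; its two terms are
    [- 2] times the integrand on the left and [k] times the integrand of [Phi k]. *)
Let by_parts k : - Int (fun y => y * gauss_fun y * sin (k * y + t)) = - (k / 2) * Phi k.
Proof.
pose f y := (- 2) * (y * gauss_fun y * sin (k * y + t)) + k * (gauss_fun y * cos (k * y + t)).
have fi : intble f by apply: intbleD; exact: intbleZ.
have dF (y : R) : is_derive y (1 : R) (fun y => gauss_fun y * sin (k * y + t)) (f y).
  apply: is_derive_eq (is_deriveM (is_derive_gauss y) (is_derive_sin_affine k t y)) _.
  by rewrite /f /GRing.scale /=; ring.
have F0 (u : nat -> R) : gauss_fun (u n) @[n --> \oo] --> 0 ->
    gauss_fun (u n) * sin (k * u n + t) @[n --> \oo] --> 0.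
  move=> u0; apply/cvgr0Pnorm_lt => e e0.
  apply: filterS (cvgr0_norm_lt _ u0 e e0) => n; apply: le_lt_trans.
  by rewrite normrM ler_piMr// sin_max.
have g0 : gauss_fun (n.+1%:R : R) @[n --> \oo] --> (0 : R).
  apply: (cvg_comp (fun n : nat => n.+1%:R : R) _ _ (@cvg_gauss_fun R)).
  by rewrite (cvg_shiftS (fun n : nat => n%:R : R)); exact: cvgr_idn.
have cg := @continuous_gauss_fun R.
have ca : continuous (fun y : R => k * y + t).
  move=> y; apply/differentiable_continuous/derivable1_diffP.
  by have h := is_derive_affine k t y; exact: ex_derive.
have cc : continuous (fun y : R => cos (k * y + t)).
  by move=> y; apply: continuous_comp; [exact: ca|exact: continuous_cos].
have cs : continuous (fun y : R => sin (k * y + t)).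
  by move=> y; apply: continuous_comp; [exact: ca|exact: continuous_sin].
have cf : continuous f.
  move=> y; apply: cvgD; (apply: cvgM; first exact: cvg_cst).
    by apply: cvgM; [apply: cvgM; [exact: cvg_id|exact: cg]|exact: cs].
  by apply: cvgM; [exact: cg|exact: cc].
have := Int_derive_eq0 dF cf fi (F0 _ g0) (F0 _ _).
rewrite /f RintegralD//; [|exact: intbleZ|exact: intbleZ].
rewrite !RintegralZl// -/(Phi k) => h.
have {}h : - 2 * Int (fun y => y * gauss_fun y * sin (k * y + t)) + k * Phi k = 0.
  by apply: h; under eq_fun do rewrite /gauss_fun sqrrN.
by lra.
Qed.

(** The majorant [G] of the derivative in [k] does not depend on [k], so the window of radius 1
    around [k] is an arbitrary choice. *)
Let is_derive_Phi (k : R) : is_derive k (1 : R) Phi (- (k / 2) * Phi k).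
Proof.
pose f (k y : R) := gauss_fun y * cos (k * y + t).
have df (x y : R) : is_derive x (1 : R) (f ^~ y) (- (y * gauss_fun y * sin (x * y + t))).
  have h : is_derive x (1 : R) (fun x => gauss_fun y * cos (y * x + t))
      (gauss_fun y *: (- y * sin (y * x + t))).
    exact: (is_deriveZ (gauss_fun y) (is_derive_cos_affine y t x)).
  rewrite (_ : f ^~ y = (fun x => gauss_fun y * cos (y * x + t))); last first.
    by apply/funext => z; rewrite /f (mulrC y).
  by apply: (is_derive_eq h); rewrite /GRing.scale /= (mulrC y x); ring.
have d1 (x y : R) : partial1of2 f x y = - (y * gauss_fun y * sin (x * y + t)).
  by rewrite partial1of2E; have h := df x y; rewrite derive_val.
pose G (y : R) := expR (- ((y - 0) ^+ 2 / 2)).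
have iG : intble G by apply: intble_gaussv; rewrite ltr0n.
have Ik : `](k - 1), (k + 1)[%classic k by rewrite /= in_itv/= ltrBlDr ltrDl ltr01.
have if_ x : `](k - 1), (k + 1)[%classic x -> intble (f x) by move=> _; exact: intble_cos.
have derf (x y : R) : `](k - 1), (k + 1)[%classic x -> setT y -> derivable (f ^~ y) x 1.
  by move=> _ _; have h := df x y; exact: ex_derive.
have G0 y : 0 <= G y by exact: expR_ge0.
have Gub (x y : R) : `](k - 1), (k + 1)[%classic x -> setT y -> `|partial1of2 f x y| <= G y.
  move=> _ _; rewrite d1 normrN normrM; apply: le_trans (mul_gauss_le y).
  by rewrite ler_piMr// sin_max.
apply: DeriveDef.
  exact: (derivable_under_integral measurableT Ik if_ derf G0 iG Gub).
rewrite -derive1E (differentiation_under_integral measurableT Ik if_ derf G0 iG Gub).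
rewrite -by_parts -mulN1r -RintegralZl//.
by apply: eq_Rintegral => y _; rewrite d1 mulN1r.
Qed.

(** The differential equation makes [Phi k * expR (k ^+ 2 / 4)] constant, with value the Gaussian
    integral times [cos t] at [k = 0]. The free phase [t] makes the sine transform a shift of this
    formula by [pi / 2]. *)
Lemma gauss_fourier k : Int (fun y => gauss_fun y * cos (k * y + t)) =
  Num.sqrt pi * expR (- (k ^+ 2 / 4)) * cos t.
Proof.
pose g (k : R) := Phi k * expR (k ^+ 2 / 4).
have dg (x : R) : is_derive x (1 : R) g 0.
  have h1 : is_derive x (1 : R) (fun x : R => x ^+ 2 / 4) (x / 2).
    rewrite (_ : (fun x => _) = 4^-1 \*: (@GRing.exp R ^~ 2)); last first.
      by apply/funext => y; rewrite /GRing.scale /= mulrC.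
    apply: is_derive_eq (is_deriveZ 4^-1 (is_deriveX 2 (is_derive_id x (1 : R)))) _.
    by rewrite /GRing.scale /= expr1; field.
  have h2 := @is_derive1_comp R expR _ x _ _ (is_derive_expR _) h1.
  apply: is_derive_eq (is_deriveM (is_derive_Phi x) h2) _.
  by rewrite /GRing.scale /=; ring.
have := is_derive_0_is_cst k 0 dg.
rewrite /g expr0n /= mul0r expR0 mulr1 => h.
have -> : Int (fun y => gauss_fun y * cos (k * y + t)) = Phi 0 * expR (- (k ^+ 2 / 4)).
  by rewrite -h expRN mulfK// gt_eqF// expR_gt0.
rewrite /Phi; under eq_Rintegral do rewrite mul0r add0r.
by rewrite RintegralZr// ?Int_gauss 1?mulrAC//; exact: intble_gauss.
Qed.

End FourierTransform.

(** Unnormalised, of variance [v / 2] and mass [Num.sqrt (pi * v)]. A packet of parameter [s] has an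
    amplitude with [v = 2 * s] and a density with [v = s]. *)
Definition gaussv (m v y : R) : R := expR (- ((y - m) ^+ 2 / v)).

Lemma gaussv_ge0 (m v y : R) : 0 <= gaussv m v y. Proof. exact: expR_ge0. Qed.

Lemma measurable_gaussv (m v : R) : 0 < v -> measurable_fun setT (gaussv m v).
Proof. by move=> v0; exact: intble_measurable (intble_gaussv m v0). Qed.

Lemma intble_gaussvM (m v : R) (f : R -> R) : 0 < v -> measurable_fun setT f ->
  (forall y, `|f y| <= 1) -> intble (fun y => gaussv m v y * f y).
Proof.
move=> v0 mf f1; apply: dominated_intble (intble_gaussv m v0).
  by apply: measurable_funM => //; exact: measurable_gaussv.
by move=> y; rewrite normrM ger0_norm ?gaussv_ge0// ler_piMr ?gaussv_ge0.
Qed.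

Lemma Int_gaussv_cos (m v k t : R) : 0 < v ->
  Int (fun y => gaussv m v y * cos (k * (y - m) + t)) =
  Num.sqrt (pi * v) * expR (- (v * k ^+ 2 / 4)) * cos t.
Proof.
move=> v0; have s0 : 0 < Num.sqrt v by rewrite sqrtr_gt0.
have si0 : 0 < (Num.sqrt v)^-1 by rewrite invr_gt0.
pose f y := gauss_fun y * cos (k * Num.sqrt v * y + t).
have fi : intble f.
  apply: dominated_intble intble_gauss.
    apply: measurable_funM; first exact: measurable_gauss_fun.
    apply: measurableT_comp; last exact: measurable_affine.
    by apply: continuous_measurable_fun; exact: continuous_cos.
  by move=> y; rewrite normrM ger0_norm ?gauss_fun_ge0// ler_piMr ?gauss_fun_ge0// cos_max.
transitivity (Int (fun y => f ((Num.sqrt v)^-1 * y + - ((Num.sqrt v)^-1 * m)))).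
  apply: eq_Rintegral => y _; rewrite /f gauss_affineE//; congr (_ * cos (_ + _)).
  by field; rewrite gt_eqF.
rewrite Int_affine// gauss_fourier invrK exprMn sqr_sqrtr ?(ltW v0)// sqrtrM ?pi_ge0//.
by rewrite (mulrC v) -!mulrA; ring.
Qed.

Lemma Int_gaussv_sin (m v k t : R) : 0 < v ->
  Int (fun y => gaussv m v y * sin (k * (y - m) + t)) =
  Num.sqrt (pi * v) * expR (- (v * k ^+ 2 / 4)) * sin t.
Proof.
move=> v0; have E (u : R) : sin u = cos (u - pi / 2).
  by rewrite cosB cos_pihalf sin_pihalf mulr0 add0r mulr1.
under eq_Rintegral do rewrite E -addrA.
by rewrite Int_gaussv_cos// -E.
Qed.

Lemma Int_gaussv (m v : R) : 0 < v -> Int (gaussv m v) = Num.sqrt (pi * v).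
Proof.
move=> v0; have := Int_gaussv_cos m 0 0 v0.
rewrite expr0n/= mulr0 mul0r oppr0 expR0 cos0 !mulr1 => <-.
by apply: eq_Rintegral => y _; rewrite mul0r add0r cos0 mulr1.
Qed.

End Gaussian.

(** * Square-integrable wave functions *)

Section SquareIntegrable.
Variable R : realType.
Local Notation C := R[i].
Local Notation mu := (@lebesgue_measure R).
Local Notation Int f := (Rintegral mu setT f).
Local Notation intble f := (mu.-integrable setT (EFin \o f)).
Local Notation Re := complex.Re.
Local Notation Im := complex.Im.

Definition nsq (z : C) : R := Re z ^+ 2 + Im z ^+ 2.
(** Chosen in place of the modulus because real and imaginary parts can be bounded one at a time; it
    lies between [cabs] and [2 * cabs]. *)
Definition norm1 (z : C) : R := `|Re z| + `|Im z|.

Lemma ReD (z w : C) : Re (z + w) = Re z + Re w. Proof. by case: z; case: w. Qed.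
Lemma ImD (z w : C) : Im (z + w) = Im z + Im w. Proof. by case: z; case: w. Qed.
Lemma ReN (z : C) : Re (- z) = - Re z. Proof. by case: z. Qed.
Lemma ImN (z : C) : Im (- z) = - Im z. Proof. by case: z. Qed.
Lemma ReM (z w : C) : Re (z * w) = Re z * Re w - Im z * Im w.
Proof. by case: z; case: w. Qed.
Lemma ImM (z w : C) : Im (z * w) = Re z * Im w + Im z * Re w.
Proof. by case: z; case: w. Qed.
Lemma ReJ (z : C) : Re (z^*) = Re z. Proof. by case: z. Qed.
Lemma ImJ (z : C) : Im (z^*) = - Im z. Proof. by case: z. Qed.
Lemma ReR (a : R) : Re (a%:C) = a. Proof. by []. Qed.
Lemma ImR (a : R) : Im (a%:C) = 0. Proof. by []. Qed.

Definition ReIm := (ReD, ImD, ReN, ImN, ReM, ImM, ReJ, ImJ, ReR, ImR).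

Lemma complex_ext (z w : C) : Re z = Re w -> Im z = Im w -> z = w.
Proof. by case: z => a b; case: w => c d /= -> ->. Qed.

Lemma nsq_ge0 z : 0 <= nsq z. Proof. by rewrite addr_ge0 ?sqr_ge0. Qed.

Lemma nsqM z w : nsq (z * w) = nsq z * nsq w.
Proof. by rewrite /nsq !ReIm; ring. Qed.

Lemma nsqD_le z w : nsq (z + w) <= 2 * (nsq z + nsq w).
Proof.
rewrite /nsq !ReIm; have := sqr_ge0 (Re z - Re w); have := sqr_ge0 (Im z - Im w).
by rewrite -subr_ge0 => h1 h2; nra.
Qed.

Lemma nsqN z : nsq (- z) = nsq z. Proof. by rewrite /nsq !ReIm !sqrrN. Qed.
Lemma nsqR a : nsq (a%:C) = a ^+ 2. Proof. by rewrite /nsq expr0n addr0. Qed.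
Lemma nsq_expi t : nsq (expi t) = 1. Proof. by rewrite /nsq /= cos2Dsin2. Qed.

Lemma norm1_ge0 z : 0 <= norm1 z. Proof. by rewrite addr_ge0. Qed.

Lemma norm1D z w : norm1 (z + w) <= norm1 z + norm1 w.
Proof.
rewrite /norm1 !ReIm addrACA; apply: lerD; exact: ler_normD.
Qed.

Lemma norm1N z : norm1 (- z) = norm1 z. Proof. by rewrite /norm1 !ReIm !normrN. Qed.

Lemma norm1M z w : norm1 (z * w) <= norm1 z * norm1 w.
Proof.
rewrite /norm1 !ReIm.
apply: (le_trans (lerD (ler_normB _ _) (ler_normD _ _))).
by rewrite !normrM; lra.
Qed.

Lemma cabs_le_norm1 z : cabs z <= norm1 z.
Proof.
rewrite /cabs -[leRHS]ger0_norm ?norm1_ge0// -sqrtr_sqr ler_wsqrtr//.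
rewrite /norm1 sqrrD !real_normK ?num_real// lerD2r lerDl.
by rewrite mulrn_wge0// mulr_ge0.
Qed.

Lemma norm1_le_cabs z : norm1 z <= 2 * cabs z.
Proof.
have h (x y : R) : `|x| <= Num.sqrt (x ^+ 2 + y ^+ 2).
  by rewrite -sqrtr_sqr ler_wsqrtr// lerDl sqr_ge0.
by rewrite mulrDl !mul1r lerD// /cabs// addrC.
Qed.

Lemma expiD s t : expi (s + t) = expi s * expi t :> C.
Proof. by apply: complex_ext; rewrite !ReIm /= ?cosD ?sinD//; ring. Qed.

(** * Measurable complex functions and bounds on the squared L2 norm *)

Definition cmeas (f : R -> C) :=
  measurable_fun setT (fun x => Re (f x)) /\ measurable_fun setT (fun x => Im (f x)).

Lemma cmeasD f g : cmeas f -> cmeas g -> cmeas (fun x => f x + g x).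
Proof.
move=> [f1 f2] [g1 g2]; split; under eq_fun do rewrite !ReIm; exact: measurable_funD.
Qed.

Lemma cmeasN f : cmeas f -> cmeas (fun x => - f x).
Proof.
move=> [f1 f2]; split; under eq_fun do rewrite !ReIm; exact: measurableT_comp.
Qed.

Lemma cmeasM f g : cmeas f -> cmeas g -> cmeas (fun x => f x * g x).
Proof.
move=> [f1 f2] [g1 g2]; split; under eq_fun do rewrite !ReIm.
  by apply: measurable_funB; exact: measurable_funM.
by apply: measurable_funD; exact: measurable_funM.
Qed.

Lemma cmeasJ f : cmeas f -> cmeas (fun x => (f x)^*).
Proof.
move=> [f1 f2]; split; under eq_fun do rewrite ?ReJ ?ImJ; [by []|exact: measurableT_comp].
Qed.

Lemma cmeas_comp f (p : R -> R) : measurable_fun setT p -> cmeas f -> cmeas (f \o p).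
Proof. by move=> mp [f1 f2]; split;
  [exact: (measurableT_comp f1 mp)|exact: (measurableT_comp f2 mp)]. Qed.

Lemma cmeas_real (f : R -> R) : measurable_fun setT f -> cmeas (fun x => (f x)%:C).
Proof. by move=> mf; split. Qed.

Lemma cmeas_expi (f : R -> R) : measurable_fun setT f -> cmeas (fun x => expi (f x)).
Proof.
move=> mf; split; (apply: measurableT_comp mf);
  apply: continuous_measurable_fun; [exact: continuous_cos|exact: continuous_sin].
Qed.

Lemma measurable_nsq f : cmeas f -> measurable_fun setT (fun x => nsq (f x)).
Proof. by move=> [f1 f2]; apply: measurable_funD; exact: measurable_funX. Qed.

(** The integral is extended-real, so the inequality itself contains square-integrability. *)
Definition L2b (f : R -> C) (M : R) :=
  cmeas f /\ (\int[mu]_x (nsq (f x))%:E <= M%:E)%E.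

Lemma L2b_le f g M : cmeas f -> (forall x, nsq (f x) <= nsq (g x)) -> L2b g M -> L2b f M.
Proof.
move=> mf fg [mg gM]; split=> //; apply: le_trans gM.
by apply: le_eint => //; do ?exact: measurable_nsq; move=> x; exact: nsq_ge0.
Qed.

Lemma L2b_weaken f M N : M <= N -> L2b f M -> L2b f N.
Proof. by move=> MN [mf fM]; split=> //; rewrite (le_trans fM)// lee_fin. Qed.

Lemma L2bD f g M N : L2b f M -> L2b g N -> L2b (fun x => f x + g x) (2 * (M + N)).
Proof.
move=> [mf fM] [mg gN]; split; first exact: cmeasD.
apply: (@le_trans _ _ (\int[mu]_x (2 * (nsq (f x) + nsq (g x)))%:E)%E).
  apply: le_eint; last exact: (fun x => nsqD_le _ _); last exact: (fun x => nsq_ge0 _).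
    by apply: measurable_nsq; exact: cmeasD.
  by apply: measurable_funM => //; apply: measurable_funD; exact: measurable_nsq.
have mf' : measurable_fun setT (fun x => (nsq (f x))%:E).
  by apply/measurable_EFinP; exact: measurable_nsq.
have mg' : measurable_fun setT (fun x => (nsq (g x))%:E).
  by apply/measurable_EFinP; exact: measurable_nsq.
under eq_integral do rewrite EFinM.
rewrite ge0_integralZl_EFin//; last 2 first.
- by move=> x _; rewrite lee_fin addr_ge0 ?nsq_ge0.
- by apply/measurable_EFinP; apply: measurable_funD; exact: measurable_nsq.
under eq_integral do rewrite EFinD.
rewrite ge0_integralD//; last 2 first.
- by move=> x _; rewrite lee_fin nsq_ge0.
- by move=> x _; rewrite lee_fin nsq_ge0.
by rewrite EFinM lee_pmul2l ?lte_fin// EFinD leeD.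
Qed.

Lemma L2b_affine (a b : R) f M : 0 < a -> L2b f M ->
  L2b (fun x => f (a * x + b)) (a^-1 * M).
Proof.
move=> a0 [mf fM]; split; first exact: (cmeas_comp (measurable_affine a b) mf).
rewrite (@ge0_integral_affine _ a b (fun x => (nsq (f x))%:E))//.
- by rewrite EFinM lee_pmul2l// lte_fin invr_gt0.
- by apply/measurable_EFinP; exact: measurable_nsq.
- by move=> x; rewrite lee_fin nsq_ge0.
Qed.

Lemma L2b_unimodular f g M : cmeas g -> (forall x, nsq (g x) = 1) -> L2b f M ->
  L2b (fun x => g x * f x) M.
Proof.
move=> mg g1 fM; apply: L2b_le (fM); first by apply: cmeasM => //; case: fM.
by move=> x; rewrite nsqM g1 mul1r.
Qed.

Lemma L2bN f M : L2b f M -> L2b (fun x => - f x) M.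
Proof.
move=> fM; apply: L2b_le (fM); first by apply: cmeasN; case: fM.
by move=> x; rewrite nsqN.
Qed.

Definition cintble (f : R -> C) :=
  intble (fun x => Re (f x)) /\ intble (fun x => Im (f x)).

Lemma cintD f g : cintble f -> cintble g ->
  cint (fun x => f x + g x) = cint f + cint g.
Proof.
move=> [f1 f2] [g1 g2]; apply: complex_ext; rewrite ?ReIm /= -RintegralD//;
  by apply: eq_Rintegral => x _; rewrite ReIm.
Qed.

(* Cauchy-Schwarz in the additive form 2 |f g| <= t |f|^2 + |g|^2 / t. *)
Lemma braket_bound f g (F G t : R) : 0 < t -> L2b f F -> L2b g G ->
  cintble (fun x => (f x)^* * g x) /\ norm1 (braket f g) <= t * F + t^-1 * G.
Proof.
move=> t0 fF gG; have [mf hF] := fF; have [mg hG] := gG.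
have [iF {}hF] := ge0_Int_bound (measurable_nsq mf) (fun x => nsq_ge0 (f x)) hF.
have [iG {}hG] := ge0_Int_bound (measurable_nsq mg) (fun x => nsq_ge0 (g x)) hG.
pose B x := t / 2 * nsq (f x) + (t^-1 / 2) * nsq (g x).
have iB : intble B by apply: intbleD; exact: intbleZ.
have IB : Int B <= (t * F + t^-1 * G) / 2.
  rewrite RintegralD//; [|exact: intbleZ|exact: intbleZ].
  rewrite !RintegralZl//.
  have t1 : 0 <= t / 2 * (F - Int (fun x => nsq (f x))).
    by rewrite mulr_ge0 ?subr_ge0// divr_ge0// ltW.
  have t2 : 0 <= t^-1 / 2 * (G - Int (fun x => nsq (g x))).
    by rewrite mulr_ge0 ?subr_ge0// divr_ge0// invr_ge0 ltW.
  by lra.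
(* Expanding the nonnegative sum of squares with [e = 1] and with [e = -1] gives the two signs of
   the absolute value. *)
have key (a b c d : R) :
    `|a * c + b * d| <= t / 2 * (a ^+ 2 + b ^+ 2) + t^-1 / 2 * (c ^+ 2 + d ^+ 2).
  have h1 e : 0 <= t^-1 / 2 * ((t * a + e * c) ^+ 2 + (t * b + e * d) ^+ 2).
    by rewrite mulr_ge0 ?addr_ge0 ?sqr_ge0// divr_ge0// invr_ge0 ltW.
  have tn : t != 0 by rewrite gt_eqF.
  have e1 e : t^-1 / 2 * ((t * a + e * c) ^+ 2 + (t * b + e * d) ^+ 2) =
     t / 2 * (a ^+ 2 + b ^+ 2) + t^-1 / 2 * (e ^+ 2 * (c ^+ 2 + d ^+ 2)) + e * (a * c + b * d).
    by field.
  have := h1 1; have := h1 (-1); rewrite !e1 sqrrN !expr1n !mul1r => h2 h3.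
  by rewrite ler_norml; apply/andP; split; lra.
have [m1 m2] : cmeas (fun x => (f x)^* * g x) by apply: cmeasM => //; exact: cmeasJ.
have b1 x : `|Re ((f x)^* * g x)| <= B x.
  by rewrite /B /nsq !ReIm mulNr opprK; exact: key.
have b2 x : `|Im ((f x)^* * g x)| <= B x.
  rewrite /B /nsq !ReIm [X in _ <= _ + _ * X]addrC mulNr -mulrN.
  by rewrite -(sqrrN (Re (g x))); exact: key.
have i1 := dominated_intble m1 b1 iB; have i2 := dominated_intble m2 b2 iB.
split; first by split.
rewrite (splitr (t * F + _)) /norm1 /braket /cint /=; apply: lerD.
  apply: le_trans IB; apply: (le_trans (le_normr_Rintegral _ i1)) => //.
  by apply: le_Rintegral => //; exact: integrable_norm.
apply: le_trans IB; apply: (le_trans (le_normr_Rintegral _ i2)) => //.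
by apply: le_Rintegral => //; exact: integrable_norm.
Qed.

Lemma L2b_UV h a b f M : L2b f M -> L2b (UV h a b f) M.
Proof.
move=> fM; apply: L2b_unimodular.
- apply: cmeas_expi; exact: measurable_funM.
- by move=> x; exact: nsq_expi.
rewrite (_ : (fun x => _) = fun x => f (1 * x + 2 * pi * h * b%:~R)); last first.
  by apply/funext => x; rewrite mul1r.
by have := L2b_affine (2 * pi * h * b%:~R) ltr01 fM; rewrite invr1 mul1r.
Qed.

(** With [psi = r + u] and W for [UV h a b], the difference is <r|W psi> + <u|W r>. The weights in
    the two Cauchy-Schwarz bounds are inverse to each other, so that the error term [r] carries
    [t^-1] both times. *)
Lemma braket_UV_close h a b psi u (U E t : R) : 0 < t -> L2b u U ->
  L2b (fun x => psi x - u x) E ->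
  norm1 (braket psi (UV h a b psi) - braket u (UV h a b u)) <=
    2 * t^-1 * E + t * (3 * U + 2 * E).
Proof.
move=> t0 uU rE; set r := fun x => _ in rE.
have psiE x : psi x = r x + u x by rewrite /r subrK.
have pP : L2b psi (2 * (E + U)).
  by rewrite (_ : psi = fun x => r x + u x); [exact: L2bD|apply/funext => x].
have ti0 : 0 < t^-1 by rewrite invr_gt0.
have [i1 b1] := braket_bound ti0 rE (L2b_UV h a b pP).
have [i2 b2] := braket_bound t0 uU (L2b_UV h a b rE).
have [i3 _] := braket_bound t0 uU (L2b_UV h a b uU).
have -> : braket psi (UV h a b psi) =
    braket r (UV h a b psi) + (braket u (UV h a b r) + braket u (UV h a b u)).
  rewrite /braket -cintD// -cintD//; last first.
    by case: i2 i3 => [? ?] [? ?]; split; under eq_fun do rewrite !(ReD, ImD); exact: intbleD.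
  by congr cint; apply/funext => x; rewrite /UV !psiE rmorphD /=; ring.
rewrite addrA addrK; apply: le_trans (norm1D _ _) _; apply: le_trans (lerD b1 b2) _.
by rewrite invrK; lra.
Qed.

End SquareIntegrable.

(** * Plancherel bound for nonnegative amplitudes *)

Section Plancherel.
Variable R : realType.
Local Notation C := R[i].
Local Notation mu := (@lebesgue_measure R).
Local Notation Int f := (Rintegral mu setT f).
Local Notation intble f := (mu.-integrable setT (EFin \o f)).
Local Notation Re := complex.Re.
Local Notation Im := complex.Im.

Variables (h x0 t B : R) (g : R -> R).
Hypotheses (h0 : 0 < h) (ig : intble g) (g0 : forall p, 0 <= g p) (gB : forall p, g p <= B).

Let phase (y p : R) := p * (y - x0) / h + t.
Let c y := Int (fun p => g p * cos (phase y p)).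
Let s y := Int (fun p => g p * sin (phase y p)).

Let mphase : measurable_fun setT (fun z : R * R => phase z.1 z.2).
Proof.
apply: measurable_funD => //; apply: measurable_funM => //.
by apply: measurable_funM => //; apply: measurable_funB.
Qed.

Let mphase1 y : measurable_fun setT (phase y).
Proof. by have := measurableT_comp mphase (@measurable_pair1 _ _ R R y). Qed.

Let mcosphase : measurable_fun setT (fun z : R * R => cos (phase z.1 z.2)).
Proof.
apply: measurableT_comp mphase.
by apply: continuous_measurable_fun; exact: continuous_cos.
Qed.

Let msinphase : measurable_fun setT (fun z : R * R => sin (phase z.1 z.2)).
Proof.
apply: measurableT_comp mphase.
by apply: continuous_measurable_fun; exact: continuous_sin.
Qed.

Let mg : measurable_fun setT g. Proof. exact: intble_measurable. Qed.

Let mg2 : measurable_fun setT (fun z : R * R => g z.2).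
Proof. exact: measurableT_comp mg _. Qed.

Let igb (f : R -> R) : measurable_fun setT f -> (forall p, `|f p| <= 1) ->
  intble (fun p => g p * f p).
Proof.
move=> mf f1; apply: dominated_intble ig; first exact: measurable_funM.
by move=> p; rewrite normrM ger0_norm// ler_piMr.
Qed.

Let Int_gb (f : R -> R) : measurable_fun setT f -> (forall p, `|f p| <= 1) ->
  `|Int (fun p => g p * f p)| <= Int g.
Proof.
move=> mf f1; have i := igb mf f1.
apply: le_trans (le_normr_Rintegral _ i) _ => //.
apply: le_Rintegral => //; first exact: integrable_norm.
by move=> p _; rewrite normrM ger0_norm// ler_piMr.
Qed.

Let w v := gaussv x0 v.

(** Fubini gives measurability only of integrable functions of [y]; a Gaussian weight in [y] makes
    the integral integrable and is then divided out. *)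
Let measurable_Int_phase (f : R -> R) : continuous f -> (forall p, `|f p| <= 1) ->
  measurable_fun setT (fun y => Int (fun p => g p * f (phase y p))).
Proof.
move=> cf f1; have mf := continuous_measurable_fun cf.
pose F y p := w 1 y * (g p * f (phase y p)).
have iF : intble (fun y => Int (F y)).
  apply: (@intble_Int1 _ _ (w 1) g) => //.
  - apply: measurable_funM.
      exact: (measurableT_comp (measurable_gaussv x0 ltr01)).
    by apply: measurable_funM => //; exact: (measurableT_comp mf).
  - exact: intble_gaussv.
  - move=> y p; rewrite !normrM (ger0_norm (gaussv_ge0 _ _ _)) (ger0_norm (g0 p)).
    by rewrite ler_wpM2l ?gaussv_ge0// ler_piMr.
rewrite (_ : (fun y => _) = fun y => (w 1 y)^-1 * Int (F y)).
  apply: measurable_funM; last exact: intble_measurable.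
  rewrite (_ : (fun y => _) = fun y => expR ((y - x0) ^+ 2 / 1)).
    apply: measurableT_comp => //; apply: measurable_funM => //.
    by apply: measurable_funX; exact: measurable_funB.
  by apply/funext => y; rewrite /w /gaussv expRN invrK.
apply/funext => y; rewrite /F RintegralZl//.
  by rewrite mulKf// gt_eqF// expR_gt0.
by apply: igb => //; exact: (measurableT_comp mf).
Qed.

Let mc : measurable_fun setT c.
Proof. by apply: measurable_Int_phase; [exact: continuous_cos|exact: cos_max]. Qed.
Let ms : measurable_fun setT s.
Proof. by apply: measurable_Int_phase; [exact: continuous_sin|exact: sin_max]. Qed.

Lemma cmeas_wave : cmeas (fun y => cint (fun p => (g p)%:C * expi (phase y p))).
Proof.
split; rewrite /cint /=.
  by under eq_fun do under eq_Rintegral do rewrite mul0r subr0.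
by under eq_fun do under eq_Rintegral do rewrite mul0r addr0.
Qed.

Lemma nsq_wave y :
  nsq (cint (fun p => (g p)%:C * expi (phase y p))) = c y ^+ 2 + s y ^+ 2.
Proof.
rewrite /nsq /cint /=; congr (_ ^+ 2 + _ ^+ 2); apply: eq_Rintegral => p _.
  by rewrite mul0r subr0.
by rewrite mul0r addr0.
Qed.

(** The real part of the wave at [y] times the conjugate of [expi (phase y p)]. Integrated against
    [g p], it returns [c y ^+ 2 + s y ^+ 2]. *)
Let corr y p := c y * cos (phase y p) + s y * sin (phase y p).

(** By the cosine of a difference: [t] cancels and only the momentum difference [q - p] remains. *)
Let corrE y p : corr y p = Int (fun q => g q * cos ((q - p) * (y - x0) / h)).
Proof.
have E q : g q * cos ((q - p) * (y - x0) / h) =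
   g q * cos (phase y q) * cos (phase y p) + g q * sin (phase y q) * sin (phase y p).
  have -> : (q - p) * (y - x0) / h = phase y q - phase y p.
    by rewrite /phase; field; rewrite gt_eqF.
  by rewrite cosB; ring.
have i1 : intble (fun q => g q * cos (phase y q)).
  apply: igb; last by move=> q; exact: cos_max.
  exact: (measurableT_comp mcosphase (@measurable_pair1 _ _ R R y)).
have i2 : intble (fun q => g q * sin (phase y q)).
  apply: igb; last by move=> q; exact: sin_max.
  exact: (measurableT_comp msinphase (@measurable_pair1 _ _ R R y)).
have j1 : intble (fun q => g q * cos (phase y q) * cos (phase y p)).
  by apply: eq_integrable (intbleZ (cos (phase y p)) i1) => // q _; rewrite /= mulrC.
have j2 : intble (fun q => g q * sin (phase y q) * sin (phase y p)).
  by apply: eq_integrable (intbleZ (sin (phase y p)) i2) => // q _; rewrite /= mulrC.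
under eq_Rintegral do rewrite E.
by rewrite RintegralD// !RintegralZr.
Qed.

(* The Fourier transform in y of the Gaussian weight is a Gaussian in q of mass 2 pi h,
   whatever the width v. *)
Let spectral_le v p : 0 < v -> Int (fun y => w v y * corr y p) <= B * (2 * pi * h).
Proof.
move=> v0.
have mkc : measurable_fun setT (fun z : R * R => cos ((z.2 - p) * (z.1 - x0) / h)).
  apply: measurableT_comp.
    by apply: continuous_measurable_fun; exact: continuous_cos.
  apply: measurable_funM => //; apply: measurable_funM; exact: measurable_funB.
have mcos q : measurable_fun setT (fun y : R => cos ((q - p) * (y - x0) / h)).
  by have := measurableT_comp mkc (@measurable_pair2 _ _ R R q).
have mcos1 y : measurable_fun setT (fun q : R => cos ((q - p) * (y - x0) / h)).
  by have := measurableT_comp mkc (@measurable_pair1 _ _ R R y).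
have -> : Int (fun y => w v y * corr y p) =
    Int (fun y => Int (fun q => w v y * (g q * cos ((q - p) * (y - x0) / h)))).
  apply: eq_Rintegral => y _.
  by rewrite corrE RintegralZl//; apply: igb => // q; exact: cos_max.
rewrite (@Int_swap _ _ (w v) g); first last.
- move=> y q; rewrite !normrM (ger0_norm (gaussv_ge0 _ _ _)) (ger0_norm (g0 q)).
  by rewrite ler_wpM2l ?gaussv_ge0// ler_piMr// cos_max.
- exact: ig.
- exact: intble_gaussv.
- apply: measurable_funM; first exact: (measurableT_comp (measurable_gaussv x0 v0)).
  exact: measurable_funM.
(* The dual width: [v * ((q - p) / h) ^+ 2 / 4] is [(q - p) ^+ 2] divided by [4 * h ^+ 2 / v]. In
   the product of [Num.sqrt (pi * v)] with the mass of the dual Gaussian, [v] cancels. *)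
have v'0 : 0 < 4 * h ^+ 2 / v by rewrite divr_gt0// mulr_gt0// exprn_gt0.
have E q : Int (fun y => w v y * (g q * cos ((q - p) * (y - x0) / h))) =
    g q * (Num.sqrt (pi * v) * gaussv p (4 * h ^+ 2 / v) q).
  under eq_Rintegral do rewrite mulrCA.
  rewrite RintegralZl//; last by apply: intble_gaussvM => // y; exact: cos_max.
  congr (_ * _).
  have := Int_gaussv_cos x0 ((q - p) / h) 0 v0; rewrite cos0 mulr1 => H.
  transitivity (Int (fun y => gaussv x0 v y * cos ((q - p) / h * (y - x0) + 0))).
    by apply: eq_Rintegral => y _; rewrite addr0 [_ / h * _]mulrAC.
  rewrite H; congr (_ * expR (- _)).
  by field; rewrite !gt_eqF.
under eq_Rintegral do rewrite E.
have iG : intble (gaussv p (4 * h ^+ 2 / v)) by exact: intble_gaussv.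
apply: (@le_trans _ _ (Int (fun q => B * Num.sqrt (pi * v) * gaussv p (4 * h ^+ 2 / v) q))).
  apply: le_Rintegral => //; last 2 first.
  - exact: intbleZ.
  - move=> q _; rewrite -(mulrA B) ler_wpM2r//.
    by rewrite mulr_ge0 ?sqrtr_ge0 ?gaussv_ge0.
  apply: (dominated_intble _ _ (intbleZ (B * Num.sqrt (pi * v)) iG)).
    apply: measurable_funM => //; apply: measurable_funM => //; exact: measurable_gaussv.
  move=> q; rewrite ger0_norm; last by rewrite !mulr_ge0 ?sqrtr_ge0 ?gaussv_ge0.
  by rewrite -(mulrA B) ler_wpM2r// mulr_ge0 ?sqrtr_ge0 ?gaussv_ge0.
rewrite RintegralZl// Int_gaussv// -(mulrA B) -sqrtrM ?mulr_ge0 ?pi_ge0 ?(ltW v0)//.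
rewrite (_ : pi * v * (pi * (4 * h ^+ 2 / v)) = (2 * pi * h) ^+ 2); last first.
  by field; rewrite gt_eqF.
by rewrite sqrtr_sqr ger0_norm// !mulr_ge0 ?pi_ge0 ?(ltW h0).
Qed.

(** The weighted square is the double integral of [w v y * corr y p * g p]; after the exchange of
    integrals, [spectral_le] bounds the integral over [y] for each [p], and [g] is integrated
    last. *)
Let weighted_le v : 0 < v ->
  intble (fun y => w v y * (c y ^+ 2 + s y ^+ 2)) /\
  Int (fun y => w v y * (c y ^+ 2 + s y ^+ 2)) <= B * (2 * pi * h) * Int g.
Proof.
move=> v0; have G0 : 0 <= Int g by exact: Rintegral_ge0.
pose f y p := w v y * corr y p * g p.
have mcorr : measurable_fun setT (fun z : R * R => corr z.1 z.2).
  by apply: measurable_funD; apply: measurable_funM => //;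
    [exact: (measurableT_comp mc)|exact: (measurableT_comp ms)].
have mf : measurable_fun setT (fun z : R * R => f z.1 z.2).
  apply: measurable_funM => //; apply: measurable_funM => //.
  exact: (measurableT_comp (measurable_gaussv x0 v0)).
have mcos1 y p : measurable_fun setT (fun q : R => cos ((q - p) * (y - x0) / h)).
  apply: measurableT_comp.
    by apply: continuous_measurable_fun; exact: continuous_cos.
  by apply: measurable_funM => //; apply: measurable_funM => //; exact: measurable_funB.
have corr_le y p : `|corr y p| <= Int g.
  by rewrite corrE; apply: Int_gb => // q; exact: cos_max.
have fle y p : `|f y p| <= Int g * w v y * g p.
  rewrite /f !normrM (ger0_norm (gaussv_ge0 _ _ _)) (ger0_norm (g0 p)).
  by rewrite ler_wpM2r// mulrC ler_wpM2r ?gaussv_ge0.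
have iw : intble (fun y => Int g * w v y) by apply: intbleZ; exact: intble_gaussv.
have E y : Int (f y) = w v y * (c y ^+ 2 + s y ^+ 2).
  have i1 : intble (fun q => g q * cos (phase y q)).
    apply: igb; last by move=> q; exact: cos_max.
    exact: (measurableT_comp mcosphase (@measurable_pair1 _ _ R R y)).
  have i2 : intble (fun q => g q * sin (phase y q)).
    apply: igb; last by move=> q; exact: sin_max.
    exact: (measurableT_comp msinphase (@measurable_pair1 _ _ R R y)).
  transitivity (Int (fun p => w v y * c y * (g p * cos (phase y p)) +
                              w v y * s y * (g p * sin (phase y p)))).
    by apply: eq_Rintegral => p _; rewrite /f /corr; ring.
  rewrite RintegralD//; [|exact: intbleZ|exact: intbleZ].
  by rewrite !RintegralZl// -/(c y) -/(s y); ring.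
have If := intble_Int1 mf iw ig fle.
split; first by apply: eq_integrable If => // y _; rewrite /= E.
have -> : Int (fun y => w v y * (c y ^+ 2 + s y ^+ 2)) = Int (fun y => Int (f y)).
  by apply: eq_Rintegral => y _; rewrite E.
rewrite (Int_swap mf iw ig fle) mulrC.
have icorr p : intble (fun y => w v y * corr y p).
  apply: dominated_intble iw.
    apply: measurable_funM; first exact: measurable_gaussv.
    exact: (measurableT_comp mcorr (@measurable_pair2 _ _ R R p)).
  move=> y; rewrite normrM (ger0_norm (gaussv_ge0 _ _ _)) mulrC.
  by rewrite ler_wpM2r ?gaussv_ge0.
have E2 p : Int (f ^~ p) = Int (fun y => w v y * corr y p) * g p.
  by rewrite RintegralZr.
rewrite -RintegralZr//; apply: le_Rintegral => //.
- have mf' : measurable_fun setT (fun z : R * R => f z.2 z.1).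
    exact: (measurableT_comp mf (@measurable_swap _ _ R R)).
  by apply: (@intble_Int1 _ (fun p y => f y p) g (fun y => Int g * w v y)) => // p y; rewrite mulrC.
- by apply: eq_integrable (intbleZ (B * (2 * pi * h)) ig) => // p _; rewrite /= mulrC.
by move=> p _; rewrite E2 mulrC ler_wpM2l// spectral_le.
Qed.

(** The weights [w n.+1%:R] increase to 1, so monotone convergence carries the bound, which does not
    depend on the width, over to the unweighted integral. *)
Lemma L2b_wave : L2b (fun y => cint (fun p => (g p)%:C * expi (phase y p)))
  (2 * pi * h * B * Int g).
Proof.
split; first exact: cmeas_wave.
pose F n y := (w n.+1%:R y * (c y ^+ 2 + s y ^+ 2))%:E.
have msq : measurable_fun setT (fun y => c y ^+ 2 + s y ^+ 2).
  by apply: measurable_funD; exact: measurable_funX.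
have mF n : measurable_fun setT (F n).
  apply/measurable_EFinP; apply: measurable_funM => //; exact: measurable_gaussv.
have F0 n y : setT y -> (0 <= F n y)%E.
  by move=> _; rewrite lee_fin mulr_ge0 ?gaussv_ge0// addr_ge0 ?sqr_ge0.
have ndF y : setT y -> nondecreasing_seq (F ^~ y).
  move=> _ m n mn; rewrite lee_fin ler_wpM2r ?addr_ge0 ?sqr_ge0//.
  rewrite ler_expR lerN2 ler_wpM2l ?sqr_ge0// lef_pV2 ?posrE ?ltr0n//.
  by rewrite ler_nat.
have cv := @cvg_monotone_convergence _ _ R mu setT measurableT F mF F0 ndF.
have limF y : limn (F ^~ y) = (nsq (cint (fun p => (g p)%:C * expi (phase y p))))%:E.
  rewrite nsq_wave; apply: cvg_lim => //; apply: cvg_EFin; first exact: nearW.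
  rewrite -[X in _ --> X]mul1r; apply: cvgM; last exact: cvg_cst.
  rewrite -[X in _ --> X]expR0; apply: continuous_cvg; first exact: continuous_expR.
  rewrite -[X in _ --> X]oppr0; apply: cvgN.
  rewrite -[X in _ --> X](mulr0 ((y - x0) ^+ 2)).
  by apply: cvgM; [exact: cvg_cst|exact: cvg_harmonic].
under eq_integral do rewrite -limF.
apply: (cvge_to_le cv); apply: nearW => n.
have [i l] := weighted_le (ltr0Sn R n).
by rewrite /F EFin_Int// lee_fin (le_trans l)// (mulrC B).
Qed.

End Plancherel.

(** * Gaussian wave packets *)

Section WavePackets.
Variable R : realType.
Local Notation C := R[i].
Local Notation mu := (@lebesgue_measure R).
Local Notation Int f := (Rintegral mu setT f).
Local Notation intble f := (mu.-integrable setT (EFin \o f)).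
Local Notation Re := complex.Re.
Local Notation Im := complex.Im.

Lemma Re_realM_expi (a t : R) : Re (a%:C * expi t) = a * cos t.
Proof. by rewrite /= mul0r subr0. Qed.

Lemma Im_realM_expi (a t : R) : Im (a%:C * expi t) = a * sin t.
Proof. by rewrite /= mul0r addr0. Qed.

Lemma conj_realM_expi (a t : R) : ((a%:C * expi t)^*)%R = a%:C * expi (- t) :> C.
Proof.
apply: complex_ext.
  by rewrite [LHS]ReJ !Re_realM_expi cosN.
by rewrite [LHS]ImJ !Im_realM_expi sinN mulrN.
Qed.

Lemma realCM (a b : R) : (a * b)%:C = a%:C * b%:C.
Proof. by apply: complex_ext; rewrite /= ?mulr0 ?mul0r ?subr0 ?addr0. Qed.

Lemma cintZ (a : R) (f : R -> C) : cintble f ->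
  cint (fun x => a%:C * f x) = a%:C * cint f.
Proof.
move=> [f1 f2]; apply: complex_ext; rewrite !ReIm mul0r ?subr0 ?addr0 /= -RintegralZl//;
  by apply: eq_Rintegral => x _; rewrite !ReIm mul0r ?subr0 ?addr0.
Qed.

Lemma cintble_expi (g f : R -> R) : measurable_fun setT f -> intble g ->
  cintble (fun x => (g x)%:C * expi (f x)).
Proof.
move=> mf ig; have mg := intble_measurable ig.
have ing : intble (fun x => `|g x|) by exact: integrable_norm.
split.
- under eq_fun do rewrite Re_realM_expi.
  apply: dominated_intble ing.
    apply: measurable_funM => //; apply: measurableT_comp => //.
    by apply: continuous_measurable_fun; exact: continuous_cos.
  by move=> x; rewrite normrM ler_piMr// cos_max.
- under eq_fun do rewrite Im_realM_expi.
  apply: dominated_intble ing.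
    apply: measurable_funM => //; apply: measurableT_comp => //.
    by apply: continuous_measurable_fun; exact: continuous_sin.
  by move=> x; rewrite normrM ler_piMr// sin_max.
Qed.

Lemma measurable_phase (k m t : R) : measurable_fun setT (fun x : R => k * (x - m) + t).
Proof.
by apply: measurable_funD => //; apply: measurable_funM => //; exact: measurable_funB.
Qed.

Lemma cint_gaussv (m v k t : R) : 0 < v ->
  cint (fun x => (gaussv m v x)%:C * expi (k * (x - m) + t)) =
  (Num.sqrt (pi * v) * expR (- (v * k ^+ 2 / 4)))%:C * expi t.
Proof.
move=> v0; apply: complex_ext.
  rewrite Re_realM_expi -(Int_gaussv_cos m)//.
  by apply: eq_Rintegral => x _; rewrite Re_realM_expi.
rewrite Im_realM_expi -(Int_gaussv_sin m)//.
by apply: eq_Rintegral => x _; rewrite Im_realM_expi.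
Qed.

Variable h : R.
Hypothesis h0 : 0 < h.
Let hn0 : h != 0. Proof. by rewrite gt_eqF. Qed.

(* The Gaussian state of position variance s / 2 centred at (X, P); it is normalised when
   c ^+ 2 * sqrt (pi * s) = 1. *)
Definition packet (c s X P t x : R) : C :=
  (c * gaussv X (2 * s) x)%:C * expi (P * x / h + t).

Definition peak (s : R) : R := powR (pi * s) (- 4^-1).

Lemma peak_normalized (s : R) : 0 < s -> peak s ^+ 2 * Num.sqrt (pi * s) = 1.
Proof.
move=> s0; have ps : 0 < pi * s by rewrite mulr_gt0 ?pi_gt0.
rewrite -powR12_sqrt ?(ltW ps)// expr2 /peak -!powRD ?(gt_eqF ps) ?implybT//.
by rewrite (_ : _ + _ = 0) ?powRr0//; field.
Qed.

Lemma coh_packet (x0 p0 : R) : coh h x0 p0 = packet (peak h) h x0 p0 (- (p0 * x0 / (2 * h))).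
Proof. by apply/funext => x; rewrite /coh /packet /gaussv realCM mulNr. Qed.

(** * Norms, tails and matrix elements of a packet *)

Section Packet.
Variables (c s X P t : R).
Hypotheses (s0 : 0 < s) (cs : c ^+ 2 * Num.sqrt (pi * s) = 1).

Let s2 : 0 < 2 * s. Proof. by rewrite mulr_gt0. Qed.

Lemma nsq_packet x : nsq (packet c s X P t x) = c ^+ 2 * gaussv X s x.
Proof.
rewrite nsqM nsqR nsq_expi mulr1 exprMn; congr (_ * _).
by rewrite /gaussv -expRM_natl; congr expR; field; rewrite gt_eqF.
Qed.

Lemma cmeas_packet : cmeas (packet c s X P t).
Proof.
apply: cmeasM.
  by apply: cmeas_real; apply: measurable_funM => //; exact: measurable_gaussv.
by apply: cmeas_expi; apply: measurable_funD => //; do 2 apply: measurable_funM => //.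
Qed.

Lemma L2b_packet : L2b (packet c s X P t) 1.
Proof.
split; first exact: cmeas_packet.
under eq_integral do rewrite nsq_packet.
rewrite EFin_Int; last by apply: intbleZ; exact: intble_gaussv.
by rewrite lee_fin RintegralZl ?Int_gaussv ?cs//; exact: intble_gaussv.
Qed.

(** Half of the exponent is spent on the distance [d]; the other half remains as a Gaussian of
    doubled width, which is still integrable. *)
Lemma gaussv_far (m v d y : R) : 0 < v -> 0 <= d -> d <= `|y - m| ->
  gaussv m v y <= expR (- (d ^+ 2 / (2 * v))) * gaussv m (2 * v) y.
Proof.
move=> v0 d0 dy; rewrite /gaussv -expRD ler_expR -opprD lerN2.
rewrite [leRHS](_ : _ = (y - m) ^+ 2 / (2 * v) + (y - m) ^+ 2 / (2 * v)).
  rewrite lerD2r ler_wpM2r ?invr_ge0 ?mulr_ge0 ?(ltW v0)//.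
  by rewrite -(real_normK (num_real (y - m))) ler_pXn2r ?nnegrE.
by field; rewrite gt_eqF.
Qed.

(** The multiplier sees the packet only at distance at least [d] from [X], where [gaussv_far]
    applies. [Num.sqrt 2] is the ratio of the masses at widths [2 * s] and [s]. *)
Lemma L2b_packet_tail (f : R -> C) (d K : R) : cmeas f -> 0 <= d -> 0 <= K ->
  (forall x, nsq (f x) <= K) -> (forall x, `|x - X| < d -> f x = 0) ->
  L2b (fun x => f x * packet c s X P t x) (K * Num.sqrt 2 * expR (- (d ^+ 2 / (2 * s)))).
Proof.
move=> mf d0 K0 fK fd.
have mfp : cmeas (fun x => f x * packet c s X P t x) by apply: cmeasM => //; exact: cmeas_packet.
split=> //; pose e := expR (- (d ^+ 2 / (2 * s))).
have e0 : 0 <= e by exact: expR_ge0.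
have ig : intble (gaussv X (2 * s)) by exact: intble_gaussv.
apply: (@le_trans _ _ (\int[mu]_x (K * c ^+ 2 * e * gaussv X (2 * s) x)%:E)%E).
  apply: le_eint; [exact: measurable_nsq| |by move=> x; exact: nsq_ge0|].
    by apply: measurable_funM => //; exact: measurable_gaussv.
  move=> x; rewrite nsqM nsq_packet.
  have [xd|xd] := ltP `|x - X| d.
    by rewrite fd// (nsqR 0) expr0n mul0r mulr_ge0 ?gaussv_ge0// mulr_ge0// mulr_ge0// sqr_ge0.
  have cg0 : 0 <= c ^+ 2 * gaussv X s x by rewrite mulr_ge0 ?sqr_ge0 ?gaussv_ge0.
  rewrite -!(mulrA K) -(mulrA (c ^+ 2)); apply: ler_pM; rewrite ?nsq_ge0//.
  by rewrite ler_wpM2l ?sqr_ge0// gaussv_far.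
rewrite EFin_Int; last exact: intbleZ.
rewrite lee_fin RintegralZl// Int_gaussv//.
have -> : Num.sqrt (pi * (2 * s)) = Num.sqrt 2 * Num.sqrt (pi * s).
  by rewrite mulrCA sqrtrM.
rewrite [leLHS](_ : _ = K * Num.sqrt 2 * e * (c ^+ 2 * Num.sqrt (pi * s))).
  by rewrite cs mulr1.
by ring.
Qed.

(** The product of the Gaussians centred at [X] and [X - d] is a Gaussian at the midpoint [m] times
    [expR (- (d ^+ 2 / (4 * s)))]; its Fourier transform at frequency [2 * pi * a] gives the rest.
    Evaluating that phase at [m] instead of [X] produces the term in [a * b], which is the same for
    all packets. *)
Lemma braket_packet_UV (a b : int) :
  braket (packet c s X P t) (UV h a b (packet c s X P t)) =
  (expR (- (s * (2 * pi * a%:~R) ^+ 2 / 4 + (2 * pi * h * b%:~R) ^+ 2 / (4 * s))))%:C *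
  expi (2 * pi * (a%:~R * X + b%:~R * P) - 2 * pi ^+ 2 * h * a%:~R * b%:~R).
Proof.
set d := 2 * pi * h * b%:~R; pose m := X - d / 2.
have sn0 : s != 0 by rewrite gt_eqF.
pose K := c ^+ 2 * expR (- (d ^+ 2 / (4 * s))).
have E x : (packet c s X P t x)^* * UV h a b (packet c s X P t) x =
    K%:C * ((gaussv m s x)%:C * expi (2 * pi * a%:~R * (x - m) +
       (2 * pi * a%:~R * m + 2 * pi * b%:~R * P))).
  have e1 : gaussv X (2 * s) x * gaussv X (2 * s) (x + d) =
      expR (- (d ^+ 2 / (4 * s))) * gaussv m s x.
    by rewrite /gaussv -!expRD /m; congr expR; field.
  have e2 : expi (2 * pi * a%:~R * (x - m) + (2 * pi * a%:~R * m + 2 * pi * b%:~R * P)) =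
      expi (- (P * x / h + t)) * (expi (2 * pi * a%:~R * x) * expi (P * (x + d) / h + t)) :> C.
    by rewrite -!expiD; congr expi; rewrite /d; field.
  rewrite /UV /packet -/d e2 conj_realM_expi.
  transitivity ((K * gaussv m s x)%:C *
     (expi (- (P * x / h + t)) *
      (expi (2 * pi * a%:~R * x) * expi (P * (x + d) / h + t)))); last first.
    by rewrite realCM -mulrA.
  rewrite /K -(mulrA (c ^+ 2)) -e1 expr2 mulrACA realCM.
  by ring.
rewrite /braket; under eq_fun do rewrite E.
rewrite cintZ; last by apply: cintble_expi; [exact: measurable_phase|exact: intble_gaussv].
rewrite cint_gaussv// (mulrA K%:C) -realCM; congr (_%:C * expi _); last first.
  by rewrite /m /d; field.
rewrite opprD expRD /K.
transitivity (c ^+ 2 * Num.sqrt (pi * s) *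
    (expR (- (s * (2 * pi * a%:~R) ^+ 2 / 4)) * expR (- (d ^+ 2 / (4 * s))))).
  by ring.
by rewrite cs mul1r.
Qed.

End Packet.

(** * Momentum bands of a coherent packet *)

Section Projection.
Variables (X P t : R).
Local Notation f := (packet (peak h) h X P t).

Let cs := peak_normalized h0.
Let h2 : 0 < 2 * h. Proof. by rewrite mulr_gt0. Qed.

Lemma fourier_packet p : fourier h f p =
  (peak h * Num.sqrt (pi * (2 * h)) * gaussv P (2 * h) p)%:C * expi ((P - p) * X / h + t).
Proof.
have E y : f y * expi (- (p * y) / h) =
    (peak h)%:C * ((gaussv X (2 * h) y)%:C * expi ((P - p) / h * (y - X) + ((P - p) * X / h + t))).
  rewrite /packet realCM -!mulrA -expiD; congr (_ * (_ * expi _)).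
  by field.
rewrite /fourier; under eq_fun do rewrite E.
rewrite cintZ; last by apply: cintble_expi; [exact: measurable_phase|exact: intble_gaussv].
rewrite cint_gaussv// (mulrA (peak h)%:C) -realCM; congr (_%:C * _).
rewrite (mulrA (peak h)) /gaussv; congr (_ * expR (- _)).
by field.
Qed.

(** [Ep] and [Op] are, by conversion, the cases of [inEven] and its complement, so one estimate
    serves both bands. *)
Definition proj (E : R -> bool) (g : R -> C) (x : R) : C :=
  ((2 * pi * h)^-1)%:C * cint (fun p => ind R (E p) * fourier h g p * expi (p * x / h)).

Definition cut (E : R -> bool) (p : R) : R := if E p then gaussv P (2 * h) p else 0.

Let amp := (2 * pi * h)^-1 * (peak h * Num.sqrt (pi * (2 * h))).

Lemma intble_cut E : measurable_fun setT E -> intble (cut E).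
Proof.
move=> mE; apply: dominated_intble (intble_gaussv P h2).
  by apply: measurable_fun_ifT => //; exact: measurable_gaussv.
by move=> p; rewrite /cut; case: ifP => _; rewrite ?normr0 ?ger0_norm ?expR_ge0.
Qed.

(** The phase [(P - p) * X / h] of the transform joins [p * x / h], leaving the nonnegative
    amplitude [cut E] in the form that [L2b_wave] accepts. *)
Lemma proj_packet E x : measurable_fun setT E ->
  proj E f x = amp%:C * cint (fun p => (cut E p)%:C * expi (p * (x - X) / h + (P * X / h + t))).
Proof.
move=> mE; rewrite /proj.
have EE p : ind R (E p) * fourier h f p * expi (p * x / h) =
    (peak h * Num.sqrt (pi * (2 * h)))%:C *
    ((cut E p)%:C * expi (p * (x - X) / h + (P * X / h + t))).
  rewrite fourier_packet /cut /ind; case: ifP => _; last by rewrite !mul0r mulr0.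
  rewrite mul1r -!mulrA -expiD !realCM -!mulrA; do 3 congr (_ * _).
  by congr expi; field.
under eq_fun do rewrite EE.
rewrite cintZ; first by rewrite (mulrA (2 * pi * h)^-1%:C) -realCM.
apply: cintble_expi; last exact: intble_cut.
by apply: measurable_funD => //; do 2 apply: measurable_funM => //; exact: measurable_funB.
Qed.

(** The two cut amplitudes add up to the full Gaussian, for which Fourier inversion is an explicit
    computation. *)
Lemma proj_compl E x : measurable_fun setT E ->
  proj E f x + proj (fun p => ~~ E p) f x = f x.
Proof.
move=> mE; have mE' : measurable_fun setT (fun p => ~~ E p) by exact: measurable_neg.
rewrite !proj_packet// -mulrDr -cintD; last 2 first.
- apply: cintble_expi; last exact: intble_cut.
  by apply: measurable_funD => //; do 2 apply: measurable_funM => //; exact: measurable_funB.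
- apply: cintble_expi; last exact: intble_cut.
  by apply: measurable_funD => //; do 2 apply: measurable_funM => //; exact: measurable_funB.
have EE p : (cut E p)%:C * expi (p * (x - X) / h + (P * X / h + t)) +
    (cut (fun p => ~~ E p) p)%:C * expi (p * (x - X) / h + (P * X / h + t)) =
    (gaussv P (2 * h) p)%:C * expi ((x - X) / h * (p - P) + (P * x / h + t)).
  rewrite -mulrDl /cut; congr (_ * expi _); last by field.
  by case: (E p); rewrite ?addr0 ?add0r.
under eq_fun do rewrite EE.
rewrite cint_gaussv// (mulrA amp%:C) -realCM; congr (_%:C * _).
transitivity ((2 * pi * h)^-1 * (Num.sqrt (pi * (2 * h)) ^+ 2) * peak h *
    expR (- (2 * h * ((x - X) / h) ^+ 2 / 4))).
  by rewrite /amp; ring.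
rewrite sqr_sqrtr; last by rewrite mulr_ge0 ?pi_ge0// ltW.
rewrite /gaussv; have -> : 2 * h * ((x - X) / h) ^+ 2 / 4 = (x - X) ^+ 2 / (2 * h) by field.
have pn : (pi : R) != 0 by rewrite gt_eqF ?pi_gt0.
by move: pn; generalize (pi : R) => q qn; field; rewrite hn0 qn.
Qed.

(** The amplitude is at most [B], its value at distance [d], and its integral at most the full mass
    [Num.sqrt 2 * Num.sqrt (pi * h)]. As [amp ^+ 2 * (2 * pi * h)] is [peak h ^+ 2], normalisation
    leaves [Num.sqrt 2 * B]. *)
Lemma L2b_proj (E : R -> bool) (d : R) : measurable_fun setT E -> 0 <= d ->
  (forall p, E p -> d <= `|p - P|) ->
  L2b (proj E f) (Num.sqrt 2 * expR (- (d ^+ 2 / (2 * h)))).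
Proof.
move=> mE d0 Ed; pose B := expR (- (d ^+ 2 / (2 * h))).
have ic := intble_cut mE.
have c0 p : 0 <= cut E p by rewrite /cut; case: ifP; rewrite ?expR_ge0.
have cB p : cut E p <= B.
  rewrite /cut; case: ifP => [/Ed dp|_]; last exact: expR_ge0.
  rewrite /gaussv ler_expR lerN2 ler_wpM2r ?invr_ge0 ?(ltW h2)//.
  by rewrite -(real_normK (num_real (p - P))) ler_pXn2r ?nnegrE.
have [mw hw] := L2b_wave X (P * X / h + t) h0 ic c0 cB.
have mamp : cmeas (proj E f).
  rewrite (_ : proj E f = fun x => amp%:C *
      cint (fun p => (cut E p)%:C * expi (p * (x - X) / h + (P * X / h + t)))).
    exact: (@cmeasM R (fun=> amp%:C) _ (@cmeas_real R (fun=> amp) (measurable_cst amp)) mw).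
  by apply/funext => x; exact: proj_packet.
split=> //.
have mn : measurable_fun setT (fun x : R => nsq (cint
    (fun p => (cut E p)%:C * expi (p * (x - X) / h + (P * X / h + t))))).
  exact: measurable_nsq.
under eq_integral do rewrite proj_packet// nsqM nsqR EFinM.
rewrite ge0_integralZl_EFin//; last 3 first.
- by move=> x _; rewrite lee_fin nsq_ge0.
- exact/measurable_EFinP.
- exact: sqr_ge0.
apply: (@le_trans _ _ ((amp ^+ 2)%:E * (2 * pi * h * B * Int (cut E))%:E)%E).
  by apply: lee_wpmul2l => //; rewrite lee_fin sqr_ge0.
have IC : Int (cut E) <= Num.sqrt 2 * Num.sqrt (pi * h).
  rewrite -sqrtrM// mulrCA -(Int_gaussv P)//; apply: le_Rintegral => //; first exact: intble_gaussv.
  by move=> p _; rewrite /cut; case: ifP; rewrite ?gaussv_ge0.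
have pn : (pi : R) != 0 by rewrite gt_eqF ?pi_gt0.
have ampE : amp ^+ 2 * (2 * pi * h) = peak h ^+ 2.
  rewrite /amp exprMn (exprMn 2 (peak h)) sqr_sqrtr; last by rewrite mulr_ge0 ?pi_ge0// ltW.
  by move: pn; generalize (pi : R) => q qn; field; rewrite hn0 qn.
rewrite -EFinM lee_fin.
rewrite [leLHS](_ : _ = peak h ^+ 2 * B * Int (cut E)); last by rewrite -ampE; ring.
apply: (@le_trans _ _ (peak h ^+ 2 * B * (Num.sqrt 2 * Num.sqrt (pi * h)))).
  by rewrite ler_wpM2l// mulr_ge0 ?sqr_ge0 ?expR_ge0.
rewrite [leLHS](_ : _ = Num.sqrt 2 * B * (peak h ^+ 2 * Num.sqrt (pi * h))); last by ring.
by rewrite cs mulr1.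
Qed.

End Projection.

End WavePackets.

(** * Dominated convergence of square partial sums *)

Section SquareSums.
Variable R : realType.
Local Notation C := R[i].
Local Notation Re := complex.Re.
Local Notation Im := complex.Im.

Definition sq1 (V : nmodType) (N : nat) (f : int -> V) : V :=
  \sum_(i < (N.*2).+1) f (zidx i).
(** Both [Qpart] and the sums in [abs_summable] are instances by conversion. *)
Definition sq2 (V : nmodType) (N : nat) (F : int -> int -> V) : V :=
  sq1 N (fun a => sq1 N (F a)).

Lemma sq1D (V : nmodType) N (f g : int -> V) :
  sq1 N (fun a => f a + g a) = sq1 N f + sq1 N g.
Proof. exact: big_split. Qed.

Lemma sq2D (V : nmodType) N (F G : int -> int -> V) :
  sq2 N (fun a b => F a b + G a b) = sq2 N F + sq2 N G.
Proof. by rewrite /sq2 -sq1D; apply: eq_bigr => i _; rewrite sq1D. Qed.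

Lemma sq2N (V : zmodType) N (F : int -> int -> V) :
  sq2 N (fun a b => - F a b) = - sq2 N F.
Proof. by rewrite /sq2 /sq1 -sumrN; apply: eq_bigr => i _; rewrite sumrN. Qed.

Lemma sq2Z (V : pzRingType) N (k : V) (F : int -> int -> V) :
  sq2 N (fun a b => k * F a b) = k * sq2 N F.
Proof. by rewrite /sq2 /sq1 mulr_sumr; apply: eq_bigr => i _; rewrite mulr_sumr. Qed.

Lemma sq1E (V : nmodType) N (f : int -> V) :
  sq1 N f = \sum_(0 <= i < (N.*2).+1) f (i%:Z - N%:Z).
Proof. by rewrite big_mkord. Qed.

Lemma sq1S (V : nmodType) N (f : int -> V) :
  sq1 N.+1 f = f (- N.+1%:Z) + (sq1 N f + f N.+1%:Z).
Proof.
rewrite !sq1E doubleS big_nat_recl// big_nat_recr//=; congr (f _ + (_ + f _)); try lia.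
by apply: eq_bigr => i _; congr f; lia.
Qed.

(** The indices gained from square [N] to square [N.+1]; the corners are counted in the two sides
    with [a] extremal. *)
Definition frame (V : nmodType) N (F : int -> int -> V) : V :=
  sq1 N.+1 (F (- N.+1%:Z)) + sq1 N.+1 (F N.+1%:Z) +
  (sq1 N (fun a => F a (- N.+1%:Z)) + sq1 N (fun a => F a N.+1%:Z)).

Lemma sq2S (V : comNzRingType) N (F : int -> int -> V) : sq2 N.+1 F = sq2 N F + frame N F.
Proof.
rewrite /sq2 sq1S /frame.
have -> : sq1 N (fun a => sq1 N.+1 (F a)) =
    sq1 N (fun a => F a (- N.+1%:Z)) +
    (sq1 N (fun a => sq1 N (F a)) + sq1 N (fun a => F a N.+1%:Z)).
  by rewrite -!sq1D; apply: eq_bigr => i _; rewrite sq1S.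
by ring.
Qed.

Lemma norm1_sum (I : Type) (r : seq I) (f : I -> C) (g : I -> R) :
  (forall i, norm1 (f i) <= g i) -> norm1 (\sum_(i <- r) f i) <= \sum_(i <- r) g i.
Proof.
move=> fg; elim/big_rec2: _ => [|i y x _ h]; first by rewrite /norm1 /= normr0 addr0.
by apply: le_trans (norm1D _ _) _; exact: lerD.
Qed.

Lemma norm1_sq1 N (f : int -> C) (g : int -> R) :
  (forall a, norm1 (f a) <= g a) -> norm1 (sq1 N f) <= sq1 N g.
Proof. by move=> fg; apply: norm1_sum. Qed.

Lemma norm1_sq2 N (F : int -> int -> C) (G : int -> int -> R) :
  (forall a b, norm1 (F a b) <= G a b) -> norm1 (sq2 N F) <= sq2 N G.
Proof. by move=> FG; do 2 apply: norm1_sum => ?. Qed.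

Lemma norm1_frame N (F : int -> int -> C) (G : int -> int -> R) :
  (forall a b, norm1 (F a b) <= G a b) ->
  norm1 (frame N F) <= frame N G.
Proof.
move=> FG; rewrite /frame; do ?(apply: le_trans (norm1D _ _) _; apply: lerD).
all: exact: norm1_sq1.
Qed.

(** Each step from one square to the next adds a frame, and frames are dominated term by term. *)
Lemma norm1_sq2B (F : int -> int -> C) (G : int -> int -> R) :
  (forall a b, norm1 (F a b) <= G a b) ->
  forall N N', (N <= N')%N ->
  norm1 (sq2 N' F - sq2 N F) <= sq2 N' G - sq2 N G.
Proof.
move=> FG N; elim=> [|N' IH].
  by rewrite leqn0 => /eqP ->; rewrite !subrr /norm1 /= normr0 addr0.
rewrite leq_eqVlt => /predU1P[<-|/IH{}IH].
  by rewrite !subrr /norm1 /= normr0 addr0.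
rewrite !sq2S addrAC [leRHS]addrAC; apply: le_trans (norm1D _ _) _.
by apply: lerD => //; exact: norm1_frame.
Qed.

Lemma norm1_Re (z : C) : `|Re z| <= norm1 z. Proof. by rewrite lerDl. Qed.
Lemma norm1_Im (z : C) : `|Im z| <= norm1 z. Proof. by rewrite lerDr. Qed.

Let small_tail (z M q e : R) : 0 <= z -> M * z <= q * z -> z * (8 * (q + 1)) < e ->
  2 * (2 * M * z) < e / 2.
Proof. by move=> *; lra. Qed.

(** * Summable coefficients against bounded matrix elements *)

Section FixedCoefficients.
Variables (A : int -> int -> C) (B : R).
Let G a b := norm1 (A a b).
Let T N := sq2 N G.
Hypothesis TB : forall N, T N <= B.

Let ndT : nondecreasing_seq T.
Proof.
move=> N N' NN'; rewrite -subr_ge0.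
have h a b : norm1 (0 : C) <= G a b by rewrite {1}/norm1 /= normr0 addr0 norm1_ge0.
exact: le_trans (norm1_ge0 _) (norm1_sq2B h NN').
Qed.

Let cvgT : cvgn T.
Proof.
by apply: nondecreasing_is_cvgn => //; exists B => _ [N _ <-].
Qed.

(* K T + u is nondecreasing and bounded. *)
Let dominated_cvgn (u : nat -> R) (K : R) :
  (forall N N', (N <= N')%N -> `|u N' - u N| <= K * (T N' - T N)) -> cvgn u.
Proof.
move=> uK; pose v N := K * T N + u N.
have cv : cvgn v.
  apply: nondecreasing_is_cvgn.
    move=> N N' /uK; rewrite ler_norml => /andP[+ _]; rewrite /v; lra.
  exists (2 * `|K| * (B - T 0%N) + `|K * T 0%N + u 0%N|) => _ [N _ <-].
  have := uK 0%N N (leq0n _); rewrite ler_norml => /andP[_ h].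
  have h1 : K * (T N - T 0%N) <= `|K| * (B - T 0%N).
    apply: (@le_trans _ _ (`|K| * (T N - T 0%N))).
      by rewrite ler_wpM2r ?ler_norm// subr_ge0 ndT.
    by rewrite ler_wpM2l// lerD2r.
  have h2 := ler_norm (K * T 0%N + u 0%N).
  by rewrite /v; lra.
rewrite (_ : u = fun N => v N - K * T N); last first.
  by apply/funext => N; rewrite /v addrC addKr.
by apply: is_cvgB => //; apply: is_cvgM => //; exact: is_cvg_cst.
Qed.

Section Bounded.
Variables (m : int -> int -> C) (M : R).
Hypothesis mM : forall a b, norm1 (m a b) <= M.
Let S N := sq2 N (fun a b => A a b * m a b).

Let S_le N N' : (N <= N')%N -> norm1 (S N' - S N) <= M * (T N' - T N).
Proof.
move=> NN'; have h a b : norm1 (A a b * m a b) <= M * G a b.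
  apply: le_trans (norm1M _ _) _.
  by rewrite mulrC ler_wpM2r// norm1_ge0.
by apply: le_trans (norm1_sq2B h NN') _; rewrite !sq2Z -mulrBr.
Qed.

(** [limn] returns an arbitrary value on a divergent sequence, so [climn] can be compared only once
    both components are known to converge. *)
Lemma cvgn_Re_sq2 : cvgn (fun N => Re (S N)).
Proof.
apply: (@dominated_cvgn _ M) => N N' NN'; apply: le_trans (S_le NN').
by rewrite -ReN -ReD norm1_Re.
Qed.

Lemma cvgn_Im_sq2 : cvgn (fun N => Im (S N)).
Proof.
apply: (@dominated_cvgn _ M) => N N' NN'; apply: le_trans (S_le NN').
by rewrite -ImN -ImD norm1_Im.
Qed.

Lemma norm1_sq2_tail N0 N : (N0 <= N)%N ->
  norm1 (S N) <= norm1 (S N0) + M * (limn T - T N0).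
Proof.
move=> NN'; rewrite -[S N](subrKC (S N0)); apply: le_trans (norm1D _ _) _.
rewrite lerD2l; apply: le_trans (S_le NN') _.
have M0 : 0 <= M by apply: le_trans (mM 0 0); exact: norm1_ge0.
by rewrite ler_wpM2l// lerD2r; exact: nondecreasing_cvgn_le.
Qed.

End Bounded.

(** Inside the square [N0] the pointwise distance [d] is used, outside it only the bound [2 * M].
    The leading 2 comes from passing to the limit in real and imaginary parts separately. *)
Lemma climn_sq2_close (m m' : int -> int -> C) (d : int -> int -> R) (M : R) N0 :
  (forall a b, norm1 (m a b) <= M) -> (forall a b, norm1 (m' a b) <= M) ->
  (forall a b, norm1 (m a b - m' a b) <= d a b) ->
  norm1 (climn (fun N => sq2 N (fun a b => A a b * m a b)) -
         climn (fun N => sq2 N (fun a b => A a b * m' a b))) <=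
  2 * (sq2 N0 (fun a b => G a b * d a b) + 2 * M * (limn T - T N0)).
Proof.
move=> mM m'M md; pose D N := sq2 N (fun a b => A a b * (m a b - m' a b)).
have DE N : D N = sq2 N (fun a b => A a b * m a b) - sq2 N (fun a b => A a b * m' a b).
  rewrite -sq2N -sq2D; apply: eq_bigr => i _; apply: eq_bigr => j _.
  by rewrite mulrBr.
have dM a b : norm1 (m a b - m' a b) <= 2 * M.
  by apply: le_trans (norm1D _ _) _; rewrite norm1N mulrDl mul1r lerD.
have D0 : norm1 (D N0) <= sq2 N0 (fun a b => G a b * d a b).
  apply: norm1_sq2 => a b; apply: le_trans (norm1M _ _) _.
  by rewrite ler_wpM2l ?norm1_ge0.
have DN N : (N0 <= N)%N ->
    norm1 (D N) <= sq2 N0 (fun a b => G a b * d a b) + 2 * M * (limn T - T N0).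
  by move=> NN0; apply: le_trans (norm1_sq2_tail dM NN0) _; rewrite lerD2r.
have lim_le (u : nat -> R) K : cvgn u -> (forall N, (N0 <= N)%N -> `|u N| <= K) -> `|limn u| <= K.
  move=> cu uK; rewrite ler_norml; apply/andP; split.
    apply: limr_ge => //; exists N0 => // N /= /uK.
    by rewrite ler_norml => /andP[].
  apply: limr_le => //; exists N0 => // N /= /uK.
  by rewrite ler_norml => /andP[].
have cR := cvgn_Re_sq2 mM; have cR' := cvgn_Re_sq2 m'M.
have cI := cvgn_Im_sq2 mM; have cI' := cvgn_Im_sq2 m'M.
rewrite mulrDl mul1r /norm1 !ReD !ReN !ImD !ImN /=; apply: lerD.
  rewrite -limB//; apply: lim_le => [|N NN0]; first exact: is_cvgB.
  by apply: le_trans (DN N NN0); apply: le_trans (norm1_Re _); rewrite DE ReD ReN.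
rewrite -limB//; apply: lim_le => [|N NN0]; first exact: is_cvgB.
by apply: le_trans (DN N NN0); apply: le_trans (norm1_Im _); rewrite DE ImD ImN.
Qed.

(** [k] may grow with (a, b): it enters only through the finite square [N0], fixed before [x] tends
    to 0. *)
Lemma tannery (m m' : R -> int -> int -> C) (eta : R -> R) (k : int -> int -> R) (M : R) :
  eta x @[x --> (0 : R)^'+] --> (0 : R) ->
  (forall x, 0 < x < 1 -> forall a b,
    [/\ norm1 (m x a b) <= M, norm1 (m' x a b) <= M &
       norm1 (m x a b - m' x a b) <= eta x + x * k a b]) ->
  cabs (climn (fun N => sq2 N (fun a b => A a b * m x a b)) -
        climn (fun N => sq2 N (fun a b => A a b * m' x a b)))
    @[x --> (0 : R)^'+] --> (0 : R).
Proof.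
move=> eta0 H; apply/cvgr0Pnorm_lt => e e0.
(* With the factor 8 the tail term of [climn_sq2_close] stays below [e / 2]; the summand 1 makes the
   divisor positive when [M] is 0. *)
have M1 : 0 < 8 * (`|M| + 1) by rewrite mulr_gt0// ltr_wpDl.
have [N0 hN0] : exists N0, `|limn T - T N0| * (8 * (`|M| + 1)) < e.
  have := cvgT => /cvgrPdist_lt/(_ _ (divr_gt0 e0 M1))[N0 _ /(_ N0 (leqnn _)) hN0].
  by exists N0; rewrite -ltr_pdivlMr.
pose f x := 2 * (eta x * T N0 + x * sq2 N0 (fun a b => G a b * k a b)).
have f0 : f x @[x --> (0 : R)^'+] --> (0 : R).
  have : f x @[x --> (0 : R)^'+] --> 2 * (0 * T N0 + 0 * sq2 N0 (fun a b => G a b * k a b)).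
    apply: cvgM; first exact: cvg_cst.
    apply: cvgD; (apply: cvgM; last exact: cvg_cst) => //.
    by apply: cvg_at_right_filter; exact: cvg_id.
  by rewrite !mul0r addr0 mulr0.
have e2 : 0 < e / 2 by rewrite divr_gt0.
near=> x.
have x01 : 0 < x < 1 by apply/andP; split; near: x; [exact: nbhs_right_gt|exact: nbhs_right_lt].
have fx : `|f x| < e / 2 by near: x; exact: cvgr0_norm_lt f0 _ e2.
rewrite ger0_norm; last by rewrite sqrtr_ge0.
apply: le_lt_trans (cabs_le_norm1 _) _.
apply: le_lt_trans (climn_sq2_close (d := fun a b => eta x + x * k a b) N0
  (fun a b => _) (fun a b => _) (fun a b => _)) _; last first.
- have -> : sq2 N0 (fun a b => G a b * (eta x + x * k a b)) =
      eta x * T N0 + x * sq2 N0 (fun a b => G a b * k a b).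
    rewrite -!sq2Z -sq2D; apply: eq_bigr => i _; apply: eq_bigr => j _; ring.
  rewrite mulrDr -/(f x) (splitr e); apply: ltrD.
    exact: le_lt_trans (ler_norm _) fx.
  have D0 : 0 <= limn T - T N0 by rewrite subr_ge0; exact: nondecreasing_cvgn_le.
  have MD : M * (limn T - T N0) <= `|M| * (limn T - T N0) by rewrite ler_wpM2r// ler_norm.
  rewrite (ger0_norm D0) in hN0; exact: small_tail D0 MD hN0.
- by move=> a b; have [] := H x x01 a b.
- by move=> a b; have [] := H x x01 a b.
- by move=> a b; have [] := H x x01 a b.
Unshelve. all: by end_near.
Qed.

End FixedCoefficients.

End SquareSums.

(** * The baker covering map *)

Section Geometry.
Variable R : realType.
Local Notation C := R[i].
Local Notation mu := (@lebesgue_measure R).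

Lemma inLeftP (x : R) :
  reflect (exists k : int, k%:~R <= x < k%:~R + 2^-1) (inLeft x).
Proof.
apply: (iffP idP) => [xl|[k /andP[kx xk]]].
  by exists (Num.floor x); rewrite ge_floor/=; move: xl; rewrite /inLeft; lra.
rewrite /inLeft (_ : Num.floor x = k); first by lra.
by apply: floor_def; rewrite kx/= intrD; lra.
Qed.

Lemma inRightP (x : R) :
  reflect (exists k : int, k%:~R + 2^-1 <= x < k%:~R + 1) (~~ inLeft x).
Proof.
apply: (iffP idP) => [|[k /andP[kx xk]]].
  rewrite /inLeft -leNgt => xr; exists (Num.floor x).
  have := floorD1_gt x; rewrite intrD; move: xr; lra.
rewrite /inLeft (_ : Num.floor x = k); first by rewrite -leNgt; lra.
by apply: floor_def; rewrite intrD; apply/andP; split; lra.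
Qed.

Lemma inLeft_shift (x : R) : inLeft (x + 2^-1) = ~~ inLeft x.
Proof.
apply/idP/idP => [|/inRightP[k hk]]; last first.
  by apply/inLeftP; exists (k + 1); rewrite intrD; lra.
apply: contraTN => /inLeftP[k hk].
by apply/inRightP; exists k; lra.
Qed.

Lemma inLeft_locally_constant (x : R) : (forall n : int, 2 * x != n%:~R) ->
  exists2 d : R, 0 < d & forall y, `|y - x| < d -> inLeft y = inLeft x.
Proof.
move=> xn; have [xl|xr] := boolP (inLeft x).
  have /inLeftP[k /andP[kx xk]] := xl.
  (* A half-open cell contains its left end, where [inLeft] jumps; the hypothesis on [2 * x] rules
     that point out. The radius is then the distance to the nearer end. *)
  have kx' : k%:~R < x.
    rewrite lt_neqAle kx andbT; apply/eqP => e.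
    by have /eqP := xn (2 * k); apply; rewrite intrM -e.
  exists (Num.min (x - k%:~R) (k%:~R + 2^-1 - x)).
    by rewrite lt_min; apply/andP; split; lra.
  move=> y; rewrite lt_min !ltr_norml => /andP[/andP[h1 h2] /andP[h3 h4]].
  by apply/idP/inLeftP; exists k; apply/andP; split; lra.
have /inRightP[k /andP[kx xk]] := xr.
have kx' : k%:~R + 2^-1 < x.
  rewrite lt_neqAle kx andbT; apply/eqP => e.
  by have /eqP := xn (2 * k + 1); apply; rewrite intrD intrM -e; field.
exists (Num.min (x - (k%:~R + 2^-1)) (k%:~R + 1 - x)).
  by rewrite lt_min; apply/andP; split; lra.
move=> y; rewrite lt_min !ltr_norml => /andP[/andP[h1 h2] /andP[h3 h4]].
by apply/negP/negP/inRightP; exists k; apply/andP; split; lra.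
Qed.

Lemma inEven_locally_constant (p : R) : (forall n : int, p != n%:~R) ->
  exists2 d : R, 0 < d & forall q, `|q - p| < d -> inEven q = inEven p.
Proof.
move=> pn; have [|d d0 hd] := @inLeft_locally_constant (p / 2).
  by move=> n; rewrite mulrC divfK.
exists (2 * d); first by rewrite mulr_gt0.
move=> q qp; apply: hd; rewrite -mulrBl normrM [`|2^-1|]ger0_norm//.
by rewrite ltr_pdivrMr// mulrC.
Qed.

Lemma measurable_inLeft : measurable_fun setT (@inLeft R).
Proof.
apply: (measurable_fun_bool true); rewrite setTI.
rewrite (_ : _ @^-1` _ = \bigcup_(k : int) `[k%:~R, k%:~R + 2^-1[%classic).
  by apply: countable_bigcupT_measurable => // k; exact: measurable_itv.
apply/seteqP; split=> x /=.
  by move=> /inLeftP[k hk]; exists k => //=; rewrite in_itv.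
by move=> [k _ /=]; rewrite in_itv/= => hk; apply/inLeftP; exists k.
Qed.

Lemma measurable_inEven : measurable_fun setT (@inEven R).
Proof.
have := measurableT_comp measurable_inLeft (_ : measurable_fun setT (fun p : R => p / 2)).
by apply; exact: measurable_funM.
Qed.

Lemma expi_2pi_int (n : int) : expi (2 * pi * n%:~R) = 1 :> C.
Proof.
have H (k : nat) : expi (2 * pi * k%:R) = 1 :> C.
  elim: k => [|k IH]; first by rewrite mulr0 /expi cos0 sin0.
  rewrite -[k.+1]addn1 natrD mulrDr mulr1 expiD IH mul1r /expi.
  by rewrite (_ : 2 * pi = pi *+ 2) ?cos2pi ?sin2pi//; rewrite mulr_natl.
case: n => k; first by rewrite -pmulrn H.
rewrite NegzE intrN mulrN -[LHS]mul1r -[1 in LHS](H k.+1) -expiD -pmulrn.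
by rewrite subrr /expi cos0 sin0.
Qed.

(** The exceptional set is a countable family of vertical and horizontal lines, a union of two
    products with a countable factor. *)
Lemma generic_ae : {ae (mu \x mu)%E, forall z : R * R,
  (forall n : int, 2 * z.1 != n%:~R) /\ (forall n : int, z.2 != n%:~R)}.
Proof.
pose D1 : set R := range (fun n : int => n%:~R / 2).
pose D2 : set R := range (fun n : int => n%:~R).
have cnt (f : int -> R) : countable (range f).
  exact: sub_countable (card_image_le _ _) (countableP _).
have mea (f : int -> R) : measurable (range f).
  rewrite (_ : range f = \bigcup_n [set f n]).
    by apply: countable_bigcupT_measurable => // n; exact: measurable_set1.
  by apply/seteqP; split=> [_ [n _ <-]|_ [n _ ->]]; exists n.
have c1 : countable D1 by exact: cnt.
have c2 : countable D2 by exact: cnt.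
have m1 : measurable D1 by exact: mea.
have m2 : measurable D2 by exact: mea.
have z1 : (mu \x mu)%E (D1 `*` setT) = 0%E.
  by rewrite product_measure1E// [X in (X * _)%E]countable_lebesgue_measure0// mul0e.
have z2 : (mu \x mu)%E (setT `*` D2) = 0%E.
  by rewrite product_measure1E// [X in (_ * X)%E]countable_lebesgue_measure0// mule0.
exists ((D1 `*` setT) `|` (setT `*` D2)); split.
- by apply: measurableU; exact: measurableX.
- by apply: null_set_setU => //; exact: measurableX.
move=> [x p] /= /not_andP[/existsNP[n]|/existsNP[n]] /negP; rewrite negbK => /eqP e.
  by left; split=> //; exists n => //=; rewrite -e mulrC mulKf.
by right; split=> //; exists n => //=.
Qed.

(* The left-hand sides are the centre of the packet produced by F: Y^(-1/2) moves x0 by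
   1/2 in odd bands and X^(-1) lowers p0 by 1 in right half-cells. *)
Lemma beta_shift (x0 p0 : R) (s := (~~ inEven p0)%:R : R)
    (u := (~~ inLeft (x0 + s / 2))%:R : R) :
  exists j l : int, 2 * x0 + s = (beta (x0, p0)).1 + j%:~R /\
    (p0 - u) / 2 = (beta (x0, p0)).2 + l%:~R.
Proof.
rewrite /beta /= /u /s; case: (inEven p0) => /=.
  rewrite mul0r !addr0; case: (inLeft x0) => /=.
    by exists 0, 0; split; lra.
  by exists 1, (-1); rewrite intrN; split; lra.
rewrite mul1r inLeft_shift negbK; case: (inLeft x0) => /=.
  by exists 0, (-1); rewrite intrN; split; lra.
by exists 1, 0; split; lra.
Qed.

End Geometry.

(** * Semiclassical limit *)

Section SemiclassicalBaker.
Variable R : realType.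
Local Notation C := R[i].

Lemma L2bZ (a : R) (f : R -> C) M : L2b f M -> L2b (fun x => a%:C * f x) (a ^+ 2 * M).
Proof.
move=> [mf fM]; split.
  exact: (@cmeasM R (fun=> a%:C) _ (@cmeas_real R (fun=> a) (measurable_cst a)) mf).
under eq_integral do rewrite nsqM nsqR EFinM.
rewrite ge0_integralZl_EFin ?sqr_ge0//; last 2 first.
- by move=> x _; rewrite lee_fin nsq_ge0.
- by apply/measurable_EFinP; exact: measurable_nsq.
by rewrite (EFinM (a ^+ 2) M) lee_wpmul2l// lee_fin sqr_ge0.
Qed.

(** * Action of F on a coherent state at fixed [h] *)

Section FixedPlanck.
Variables (h x0 p0 dp dx : R).
Hypothesis h0 : 0 < h.
Hypotheses (dp0 : 0 <= dp) (dx0 : 0 <= dx).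
Let hn0 : h != 0. Proof. by rewrite gt_eqF. Qed.
Let s := (~~ inEven p0)%:R : R.
(** The half-cell is tested at the point already moved by [s / 2], since the momentum factor of F
    acts before the position factor. *)
Let u := (~~ inLeft (x0 + s / 2))%:R : R.
Hypothesis Hp : forall p, `|p - p0| < dp -> inEven p = inEven p0.
Hypothesis Hx : forall x, `|x - (x0 + s / 2)| < dx -> inLeft x = inLeft (x0 + s / 2).

Local Notation f := (coh h x0 p0).
Let g (y : R) : C := Ep h f y + Yop (- 2^-1) (Op h f) y.

(** Replacing the right band by the state minus the wrong band leaves the wrong band twice, once in
    place and once translated by 1/2; each copy has squared norm at most [M], and
    [4 * M = 2 * (M + M)]. *)
Lemma momentum_split :
  L2b (fun y => g y - f (y - s / 2)) (4 * (Num.sqrt 2 * expR (- (dp ^+ 2 / (2 * h))))).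
Proof.
set M := Num.sqrt 2 * _.
have mE := @measurable_inEven R.
have mO : measurable_fun setT (fun p : R => ~~ inEven p) by exact: measurable_neg.
have fE y : Ep h f y + Op h f y = f y.
  by rewrite coh_packet -(proj_compl h0 x0 p0 (- (p0 * x0 / (2 * h))) y mE).
have shift (F : R -> C) : L2b F M -> L2b (fun y => F (y - 2^-1)) M.
  move=> FM; have := L2b_affine (- 2^-1) ltr01 FM; rewrite invr1 mul1r.
  by under eq_fun do rewrite mul1r.
case e : (inEven p0); rewrite /g /s e /=.
  have OM : L2b (Op h f) M.
    rewrite coh_packet; apply: (L2b_proj h0) => // p; apply: contraNT.
    by rewrite -ltNge => /Hp ->; rewrite e.
  rewrite (_ : (fun y => _) = fun y => - Op h f y + Op h f (y - 2^-1)).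
    by rewrite (_ : 4 * M = 2 * (M + M)); [exact: L2bD (L2bN OM) (shift _ OM)|ring].
  by apply/funext => y; rewrite mul0r subr0 -(fE y) /Yop; ring.
have EM : L2b (Ep h f) M.
  rewrite coh_packet; apply: (L2b_proj h0) => // p; apply: contraTT.
  by rewrite -ltNge => /Hp ->; rewrite e.
rewrite (_ : (fun y => _) = fun y => Ep h f y + - Ep h f (y - 2^-1)).
  by rewrite (_ : 4 * M = 2 * (M + M)); [exact: L2bD EM (L2bN (shift _ EM))|ring].
by apply/funext => y; rewrite mul1r -(fE (y - 2^-1)) /Yop; ring.
Qed.

Lemma coh_shift (a y : R) : f (y - a) =
  packet h (peak h) h (x0 + a) p0 (- (p0 * x0 / (2 * h)) - p0 * a / h) y.
Proof.
rewrite coh_packet /packet /gaussv; congr ((_ * expR _)%:C * expi _); last by field.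
by congr (- (_ ^+ 2 / _)); ring.
Qed.

Lemma Fop_coh_close : exists t,
  L2b (fun x => Fop h f x -
      packet h ((Num.sqrt 2)^-1 * peak h) (4 * h) (2 * x0 + s) ((p0 - u) / 2) t x)
    (8 * Num.sqrt 2 * (expR (- (dp ^+ 2 / (2 * h))) + expR (- (dx ^+ 2 / (2 * h))))).
Proof.
have h2 : h * 2 != 0 by rewrite mulf_neq0.
set t1 := - (p0 * x0 / (2 * h)) - p0 * (s / 2) / h.
exists t1.
(* [m] is the unimodular multiplier L + X^(-1) R, and [chi] the single plane wave with which it
   agrees within [dx] of the packet's centre. Multiplication by [chi] only lowers the momentum by
   [u]. *)
pose m (y : R) : C := if inLeft y then 1 else expi (-1 * y / h).
pose chi (y : R) : C := expi (- (u * y / h)).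
have me : cmeas (fun y : R => expi (-1 * y / h)).
  by apply: cmeas_expi; do 2 apply: measurable_funM => //.
have mm : cmeas m.
  rewrite /m; split.
    rewrite (_ : (fun x => _) = fun x : R => if inLeft x then 1 else cos (-1 * x / h)).
      by apply: measurable_fun_ifT; [exact: measurable_inLeft|exact: measurable_cst|exact: me.1].
    by apply/funext => x; case: ifP.
  rewrite (_ : (fun x => _) = fun x : R => if inLeft x then 0 else sin (-1 * x / h)).
    by apply: measurable_fun_ifT; [exact: measurable_inLeft|exact: measurable_cst|exact: me.2].
  by apply/funext => x; case: ifP.
have mchi : cmeas chi.
  apply: cmeas_expi; rewrite (_ : (fun y => _) = fun y : R => (- u) * y / h).
    by do 2 apply: measurable_funM => //.
  by apply/funext => y; rewrite !mulNr.
have nm y : nsq (m y) = 1.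
  by rewrite /m; case: ifP => _; [rewrite (nsqR 1) expr1n|exact: nsq_expi].
have L1 : L2b (fun y => m y * (g y - f (y - s / 2)))
    (4 * (Num.sqrt 2 * expR (- (dp ^+ 2 / (2 * h))))).
  exact: L2b_unimodular mm nm momentum_split.
pose p := packet h (peak h) h (x0 + s / 2) p0 t1.
have L2 : L2b (fun y => (m y + - chi y) * p y)
    (4 * Num.sqrt 2 * expR (- (dx ^+ 2 / (2 * h)))).
  apply: (L2b_packet_tail _ _ _ h0 (peak_normalized h0) _ dx0) => //.
  - by apply: cmeasD => //; exact: cmeasN.
  - by move=> y; apply: le_trans (nsqD_le _ _) _; rewrite nsqN nm nsq_expi; lra.
  move=> y /Hx yl; rewrite /m /chi yl /u; case: (inLeft _) => /=.
    by rewrite !mul0r oppr0 /expi cos0 sin0 subrr.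
  by rewrite mul1r mulN1r mulNr subrr.
(* The constant [8 * Num.sqrt 2] is 4 [Num.sqrt 2] times 2 from adding the two errors; the factor 2
   from dilating the line cancels the squared prefactor of [Sop]. *)
have L3 := L2bZ (Num.sqrt 2)^-1 (L2b_affine 0 (_ : 0 < 2^-1) (L2bD L1 L2)).
rewrite (_ : (fun x => _) = fun x => ((Num.sqrt 2)^-1)%:C *
    (m (2^-1 * x + 0) * (g (2^-1 * x + 0) - f (2^-1 * x + 0 - s / 2)) +
     (m (2^-1 * x + 0) + - chi (2^-1 * x + 0)) * p (2^-1 * x + 0))).
  apply: L2b_weaken (L3 _) => //; rewrite exprVn sqr_sqrtr// invrK.
  by rewrite le_eqVlt; apply/orP; left; apply/eqP; field.
apply/funext => x; rewrite addr0 (mulrC 2^-1) /Fop /Sop /Lop /Rop /Xop -/g.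
set y := x / 2.
have -> : ind R (inLeft y) * g y + expi (-1 * y / h) * (ind R (~~ inLeft y) * g y) = m y * g y.
  by rewrite /m /ind; case: (inLeft y) => /=; ring.
have -> : packet h ((Num.sqrt 2)^-1 * peak h) (4 * h) (2 * x0 + s) ((p0 - u) / 2) t1 x =
    ((Num.sqrt 2)^-1)%:C * (chi y * p y).
  have eg : gaussv (2 * x0 + s) (2 * (4 * h)) x = gaussv (x0 + s / 2) (2 * h) y.
    by rewrite /gaussv /y; congr (expR (- _)); field.
  rewrite /p /packet /chi eg (mulrCA (expi _) _ (expi _)) -expiD !realCM -!mulrA.
  by congr (_ * (_ * (_ * expi _))); rewrite /y; field.
by rewrite coh_shift -/t1 -/p; ring.
Qed.

End FixedPlanck.

(** Since [expR x >= 1 + x >= x], the exponential is at most the inverse of its exponent. A rate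
    linear in [h] is all that is kept of the exponential smallness. *)
Lemma expRN_inv_le (d h : R) : 0 < d -> 0 < h ->
  expR (- (d ^+ 2 / (2 * h))) <= 2 / d ^+ 2 * h.
Proof.
move=> d0 h0; have t0 : 0 < d ^+ 2 / (2 * h) by rewrite divr_gt0 ?exprn_gt0// mulr_gt0.
rewrite expRN (_ : 2 / d ^+ 2 * h = (d ^+ 2 / (2 * h))^-1); last first.
  by field; rewrite !gt_eqF.
rewrite lef_pV2 ?posrE ?expR_gt0//.
by apply: le_trans (expR_ge1Dx _); rewrite lerDr.
Qed.

(** Both exponentials lie between [1 - (x + y)] and 1. *)
Lemma dist_expRN_le (x y : R) : 0 <= x -> 0 <= y -> `|expR (- x) - expR (- y)| <= x + y.
Proof.
move=> x0 y0; have := expR_ge1Dx (- x); have := expR_ge1Dx (- y).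
have : expR (- x) <= 1 by rewrite -expR0 ler_expR oppr_le0.
have : expR (- y) <= 1 by rewrite -expR0 ler_expR oppr_le0.
by move=> h1 h2 h3 h4; rewrite ler_norml; apply/andP; split; lra.
Qed.

Lemma norm1_realM_expi (a t : R) : norm1 (a%:C * expi t) <= 2 * `|a|.
Proof.
rewrite /norm1 Re_realM_expi Im_realM_expi !normrM mulrDl mul1r.
by apply: lerD; rewrite ler_piMr// ?cos_max ?sin_max.
Qed.

Lemma expi_shift (n : int) (t : R) : expi (t + 2 * pi * n%:~R) = expi t :> C.
Proof. by rewrite expiD expi_2pi_int mulr1. Qed.

(** * Rate of convergence of the matrix elements *)

Section Estimate.
Variables (x0 p0 dp dx : R).
Hypotheses (dp0 : 0 < dp) (dx0 : 0 < dx).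
Let s := (~~ inEven p0)%:R : R.
Let u := (~~ inLeft (x0 + s / 2))%:R : R.
Hypothesis Hp : forall p, `|p - p0| < dp -> inEven p = inEven p0.
Hypothesis Hx : forall x, `|x - (x0 + s / 2)| < dx -> inLeft x = inLeft (x0 + s / 2).

Let K := 8 * Num.sqrt 2 * (2 / dp ^+ 2 + 2 / dx ^+ 2).
(** [h * rate a b] is twice the sum of the damping exponents at widths [4 * h] and [h], both
    proportional to [h]. *)
Let rate (a b : int) : R := 2 * ((4 * (2 * pi * a%:~R) ^+ 2 / 4 + (2 * pi * b%:~R) ^+ 2 / 16) +
  ((2 * pi * a%:~R) ^+ 2 / 4 + (2 * pi * b%:~R) ^+ 2 / 4)).

Let cohF h := Fop h (coh h x0 p0).
Let cohB h := coh h (beta (x0, p0)).1 (beta (x0, p0)).2.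

(** Shaped for [tannery]: two bounds uniform in the modes and in [h], and a difference made of a
    uniform part and a part linear in [h] whose slope depends on the mode. *)
Lemma braket_estimate (h : R) (a b : int) : 0 < h < 1 ->
  [/\ norm1 (braket (cohF h) (UV h a b (cohF h))) <= (4 * K + 3) + 2,
     norm1 (braket (cohB h) (UV h a b (cohB h))) <= (4 * K + 3) + 2 &
     norm1 (braket (cohF h) (UV h a b (cohF h)) - braket (cohB h) (UV h a b (cohB h))) <=
       Num.sqrt h * (4 * K + 3) + h * rate a b].
Proof.
move=> /andP[h0 h1].
have K0 : 0 <= K by rewrite mulr_ge0 ?mulr_ge0// addr_ge0// divr_ge0// sqr_ge0.
have r0 : 0 < Num.sqrt h by rewrite sqrtr_gt0.
have r1 : Num.sqrt h <= 1 by rewrite -sqrtr1 ler_sqrt// ltW.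
have rr : Num.sqrt h ^+ 2 = h by rewrite sqr_sqrtr// ltW.
have [t Ft] := Fop_coh_close h0 (ltW dp0) (ltW dx0) Hp Hx.
have {}Ft := L2b_weaken (N := K * h) _ Ft.
set w := packet h _ _ _ _ t in Ft.
have h4 : 0 < 4 * h by rewrite mulr_gt0.
have cs : ((Num.sqrt 2)^-1 * peak h) ^+ 2 * Num.sqrt (pi * (4 * h)) = 1 :> R.
  have -> : Num.sqrt (pi * (4 * h)) = 2 * Num.sqrt (pi * h).
    rewrite mulrCA sqrtrM// (_ : 4 = 2 ^+ 2 :> R); last by ring.
    by rewrite sqrtr_sqr ger0_norm.
  rewrite exprMn exprVn sqr_sqrtr// -[RHS](peak_normalized h0).
  by field.
(* The weight [Num.sqrt h] balances the error [K * h] divided by the weight against the weight times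
   the norm of [w]. *)
have close : norm1 (braket (cohF h) (UV h a b (cohF h)) - braket w (UV h a b w)) <=
    Num.sqrt h * (4 * K + 3).
  apply: le_trans (braket_UV_close h a b r0 (L2b_packet _ _ _ _ h4 cs) (Ft _)) _.
    rewrite /K -(mulrA (8 * Num.sqrt 2)) ler_wpM2l ?mulr_ge0//.
    apply: le_trans (lerD (expRN_inv_le dp0 h0) (expRN_inv_le dx0 h0)) _.
    by rewrite -mulrDl.
  have -> : 2 * (Num.sqrt h)^-1 * (K * h) = Num.sqrt h * (2 * K).
    by rewrite -{2}rr; field; rewrite gt_eqF.
  rewrite -mulrDr ler_wpM2l ?(ltW r0)//.
  have : K * h <= K by rewrite ler_piMr// ltW.
  by lra.
have [j [l [Xj Pl]]] := beta_shift x0 p0.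
have csB := peak_normalized h0.
pose e1 := 4 * h * (2 * pi * a%:~R) ^+ 2 / 4 + (2 * pi * h * b%:~R) ^+ 2 / (4 * (4 * h)).
pose e2 := h * (2 * pi * a%:~R) ^+ 2 / 4 + (2 * pi * h * b%:~R) ^+ 2 / (4 * h).
pose q := 2 * pi * (a%:~R * (beta (x0, p0)).1 + b%:~R * (beta (x0, p0)).2) -
   2 * pi ^+ 2 * h * a%:~R * b%:~R.
(* The integers [j] and [l] contribute a multiple of [2 * pi], so both matrix elements carry the
   same phase [q] and differ only by their damping. *)
have wE : braket w (UV h a b w) = (expR (- e1))%:C * expi q.
  rewrite /w braket_packet_UV// -/s -/u Xj Pl; congr (_ * _).
  rewrite -(expi_shift (a * j + b * l) q); congr expi.
  by rewrite intrD !intrM /q; ring.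
have BE : braket (cohB h) (UV h a b (cohB h)) = (expR (- e2))%:C * expi q.
  by rewrite /cohB coh_packet braket_packet_UV.
have ge0 (v v' x y : R) : 0 < v -> 0 < v' -> 0 <= v * x ^+ 2 / 4 + y ^+ 2 / v'.
  move=> v0 w0; apply: addr_ge0; apply: divr_ge0 => //; [|exact: sqr_ge0|exact: ltW].
  by rewrite pmulr_rge0// sqr_ge0.
have e10 : 0 <= e1 by apply: ge0 => //; exact: mulr_gt0.
have e20 : 0 <= e2 by apply: ge0 => //; exact: mulr_gt0.
have expR_le2 e : 0 <= e -> norm1 ((expR (- e))%:C * expi q) <= 2.
  move=> e0; apply: le_trans (norm1_realM_expi _ _) _.
  by rewrite ger0_norm ?expR_ge0// -[leRHS]mulr1 ler_wpM2l// -expR0 ler_expR oppr_le0.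
split.
- rewrite -[braket _ _](subrK (braket w (UV h a b w))).
  apply: le_trans (norm1D _ _) _; apply: lerD; last by rewrite wE; exact: expR_le2.
  by apply: le_trans close _; rewrite ler_piMl//; lra.
- by rewrite BE; apply: le_trans (expR_le2 _ e20) _; lra.
rewrite -(subrKA (braket w (UV h a b w))).
apply: le_trans (norm1D _ _) _; apply: lerD => //.
rewrite wE BE -mulrBl.
have -> : (expR (- e1))%:C - (expR (- e2))%:C = (expR (- e1) - expR (- e2))%:C :> C.
  by apply: complex_ext; rewrite !ReIm ?subr0.
apply: le_trans (norm1_realM_expi _ _) _.
rewrite /rate mulrCA ler_wpM2l//; apply: le_trans (dist_expRN_le e10 e20) _.
rewrite le_eqVlt; apply/orP; left; apply/eqP; rewrite /e1 /e2.
by generalize (pi : R) => pp; field; rewrite gt_eqF.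
Qed.

End Estimate.

End SemiclassicalBaker.

Theorem theorem4 (R : realType) (A : int -> int -> R[i]) :
  abs_summable A ->
  {ae ((@lebesgue_measure R) \x (@lebesgue_measure R))%E, forall z : R * R,
     cabs (Qexp h A (Fop h (coh h z.1 z.2))
           - Qexp h A (coh h (beta z).1 (beta z).2))
       @[h --> (0 : R)^'+] --> (0 : R)}.
Proof.
move=> [M AM]; have [N [mN N0 genN]] := @generic_ae R.
exists N; split=> // -[x0 p0]; apply: contra_notP => xpN.
have /contrapT[x0n p0n] : ~ ~ ((forall n : int, 2 * x0 != n%:~R) /\ (forall n : int, p0 != n%:~R)).
  by move=> /(genN (x0, p0)).
have [dp dp0 Hp] := inEven_locally_constant p0n.
(* Genericity survives the move by 1/2: [2 * x0] changes by the integer 1. *)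
have [|dx dx0 Hx] := @inLeft_locally_constant R (x0 + (~~ inEven p0)%:R / 2).
  case: (inEven p0) => n /=; first by rewrite mul0r addr0.
  apply: contra (x0n (n - 1)) => /eqP e; apply/eqP.
  by rewrite intrD -e intrN; field.
have TB k : sq2 k (fun a b => norm1 (A a b)) <= 2 * M.
  apply: (@le_trans _ _ (sq2 k (fun a b => 2 * cabs (A a b)))).
    by apply: ler_sum => i _; apply: ler_sum => j _; exact: norm1_le_cabs.
  by rewrite sq2Z ler_wpM2l//; exact: AM.
have sqrt0 (k : R) : Num.sqrt x * k @[x --> (0 : R)^'+] --> (0 : R).
  rewrite -[X in _ --> X](mul0r k); apply: cvgM; last exact: cvg_cst.
  rewrite -[X in _ --> X](@sqrtr0 R); apply: cvg_at_right_filter.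
  exact: sqrt_continuous.
exact: (tannery TB (sqrt0 _) (fun h h01 a b => braket_estimate dp0 dx0 Hp Hx a b h01)).
Qed.
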